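(* (Diagram formula.) Let $\mu$ be a non-atomic probability measure on a measurable space $(X,\mathcal X)$, let $k_1,k_2,n\ge1$ be integers, and let $f=f(x_1,\dots,x_{k_1})$ and $g=g(x_1,\dots,x_{k_2})$ be square integrable functions on the product spaces $(X^{k_1},\mathcal X^{k_1},\mu^{k_1})$ and $(X^{k_2},\mathcal X^{k_2},\mu^{k_2})$ respectively. Then, almost surely, $$J_{n,k_1}(f)\,J_{n,k_2}(g)=\sum_{l=0}^{\min(k_1,k_2)}\sum_{p=0}^l\frac{(k_1+k_2-l-p)!}{(k_1-l)!\,(k_2-l)!\,(l-p)!\,p!}\,n^{-(l-p)/2}\,J_{n,k_1+k_2-l-p}(f\circ g_{l,p}),$$ where the functions $f\circ g_{l,p}$ of $k_1+k_2-l-p$ variables, $0\le p\le l\le\min(k_1,k_2)$, are defined by $$f\circ g_{l,p}(x_1,\dots,x_{k_1+k_2-l-p})=\frac{(k_1-l)!\,(k_2-l)!\,(l-p)!\,p!}{k_1!\,k_2!}\sum_{B(\mathcal N,\mathcal N_1)\in\mathcal B(l,p)}f\circ g_{B(\mathcal N,\mathcal N_1)}(x_1,\dots,x_{k_1+k_2-l-p}),$$ and $\mathcal B(l,p)$ is the set of those coloured diagrams $B(\mathcal N,\mathcal N_1)$ with $k_1$ vertices in the first row and $k_2$ vertices in the second row for which $|\mathcal N|=l$ and $|\mathcal N_1|=p$.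
   Context: Let $\xi_1,\dots,\xi_n$ be i.i.d. random variables with values in $(X,\mathcal X)$ and distribution $\mu$. The empirical measure is $\mu_n(A)=\frac1n\#\{j:\ \xi_j\in A,\ 1\le j\le n\}$, $A\in\mathcal X$. For a function $f$ of $k\ge1$ variables, $$J_{n,k}(f)=\frac{n^{k/2}}{k!}\int' f(u_1,\dots,u_k)\,(\mu_n(du_1)-\mu(du_1))\dots(\mu_n(du_k)-\mu(du_k)),$$ where the prime means that the diagonals $u_j=u_l$, $1\le j<l\le k$, are omitted from the domain of integration. Constants are regarded as functions of zero variables, and $J_{n,0}(c)=c$. Coloured diagrams. A diagram $B(\mathcal N)=B(\mathcal N,k_1,k_2)$ has first row of vertices $1,\dots,k_1$ and second row of vertices $k_1+1,\dots,k_1+k_2$; its set of edges is $\mathcal N=\{(j_1,j_1'),\dots,(j_l,j_l')\}$ (possibly empty) with $1\le j_1<\cdots<j_l\le k_1$, $k_1+1\le j'_s\le k_1+k_2$ and the $j'_s$ pairwise distinct. A coloured diagram $B(\mathcal N,\mathcal N_1)=B(\mathcal N,\mathcal N_1,k_1,k_2)$ is a diagram $B(\mathcal N)$ together with a subset $\mathcal N_1\subset\mathcal N$ (edges in $\mathcal N_1$ have colour $1$, edges in $\mathcal N\setminus\mathcal N_1$ have colour $-1$). The function $f\circ g_{B(\mathcal N,\mathcal N_1)}$. With $|\mathcal N|=l$, $|\mathcal N_1|=p$: start from the function $f(x_1,\dots,x_{k_1})\,g(x_{k_1+1},\dots,x_{k_1+k_2})$; for every edge $(j,j')\in\mathcal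 N$ replace the argument $x_{j'}$ by $x_j$; then for every edge $(j,j')\in\mathcal N_1$ integrate out the variable $x_j$ with respect to $\mu$; finally renumber the remaining $k_1+k_2-l-p$ variables, listed in increasing order of their indices, as $x_1,\dots,x_{k_1+k_2-l-p}$. The resulting function is $f\circ g_{B(\mathcal N,\mathcal N_1)}(x_1,\dots,x_{k_1+k_2-l-p})$ (a constant if $k_1+k_2-l-p=0$). *)

(* Defs.v *)
From HB Require Import structures.
From mathcomp Require Import all_boot all_order all_algebra.
From mathcomp Require Import all_classical all_reals all_analysis.

Set Implicit Arguments.
Unset Strict Implicit.
Unset Printing Implicit Defensive.

Import Order.TTheory GRing.Theory Num.Theory.
Import numFieldNormedType.Exports.

Local Open Scope classical_set_scope.
Local Open Scope ring_scope.

Section measures.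
Context d (X : measurableType d) (R : realType).

(* Atomless: no measurable set of positive measure is an atom.  In a general
   measurable space this is stronger than "points have measure zero" (take the
   countable-cocountable sigma-algebra), and it is what makes the diagonals
   negligible for the product measures. *)
Definition non_atomic (mu : {measure set X -> \bar R}) : Prop :=
  forall A : set X, measurable A -> (0 < mu A)%E ->
    exists B : set X,
      [/\ measurable B, B `<=` A, (0 < mu B)%E & (mu B < mu A)%E].

Definition empirical n (x : 'I_n -> X) (A : set X) : \bar R :=
  (n%:R^-1 * #|[pred j | x j \in A]|%:R)%:E.

Section empirical_measure.
Variables (n : nat) (x : 'I_n -> X).

Let diracs (k : nat) : {measure set X -> \bar R} :=
  dirac (if insub k is Some j then x j else point).

Let empiricalE :
  empirical x = mscale (n%:R^-1)%:nng (msum diracs n).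
Proof.
apply/funext => A; rewrite /empirical /mscale /msum /= EFinM; congr (_ * _)%E.
rewrite -sum1_card natr_sum -sumEFin big_mkcond/=.
apply: eq_bigr => i _; rewrite /diracs /= /dirac valK/= indicE inE.
by case: (x i \in A).
Qed.

Let empirical0 : empirical x set0 = 0%E.
Proof. by rewrite empiricalE measure0. Qed.

Let empirical_ge0 A : (0 <= empirical x A)%E.
Proof. by rewrite empiricalE measure_ge0. Qed.

Let empirical_sigma_additive : semi_sigma_additive (empirical x).
Proof. by rewrite empiricalE; exact: measure_semi_sigma_additive. Qed.

HB.instance Definition _ := isMeasure.Build _ _ _ (empirical x)
  empirical0 empirical_ge0 empirical_sigma_additive.

Let empirical_setT : (empirical x setT <= 1)%E.
Proof.
rewrite /empirical lee_fin.
rewrite (eq_card (B := predT)); last by move=> j; rewrite !inE in_setT.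
rewrite card_ord; have [->|n0] := eqVneq n 0%N; first by rewrite mulr0.
by rewrite mulVf// pnatr_eq0.
Qed.

HB.instance Definition _ :=
  Measure_isSubProbability.Build _ _ _ (empirical x) empirical_setT.

End empirical_measure.

Section product_cons.
Variables (k : nat) (nu : subprobability X R)
  (nu' : subprobability (k.-tuple X) R).

Definition tcons (u : X * k.-tuple X) : k.+1.-tuple X := [tuple of u.1 :: u.2].

Lemma measurable_tcons : measurable_fun setT tcons.
Proof. exact: measurable_cons. Qed.

Definition prod_cons : set (k.+1.-tuple X) -> \bar R :=
  pushforward (product_subprobability (nu, nu')) tcons.

Let prod_cons0 : prod_cons set0 = 0%E.
Proof. by rewrite /prod_cons /pushforward preimage_set0 measure0. Qed.

Let prod_cons_ge0 A : (0 <= prod_cons A)%E.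
Proof. by rewrite /prod_cons /pushforward measure_ge0. Qed.

Let prod_cons_sigma_additive : semi_sigma_additive prod_cons.
Proof.
move=> F mF tF mUF; rewrite /prod_cons /pushforward preimage_bigcup.
apply: measure_semi_sigma_additive.
- by move=> n; rewrite -[X in measurable X]setTI; exact: measurable_tcons.
- apply/trivIsetP => /= i j _ _ ij; rewrite -preimage_setI.
  by move/trivIsetP : tF => /(_ _ _ _ _ ij) ->//; rewrite preimage_set0.
- by rewrite -preimage_bigcup -[X in measurable X]setTI; exact: measurable_tcons.
Qed.

HB.instance Definition _ := isMeasure.Build _ _ _ prod_cons
  prod_cons0 prod_cons_ge0 prod_cons_sigma_additive.

Let prod_cons_setT : (prod_cons setT <= 1)%E.
Proof.
by rewrite /prod_cons /pushforward preimage_setT sprobability_setT.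
Qed.

HB.instance Definition _ :=
  Measure_isSubProbability.Build _ _ _ prod_cons prod_cons_setT.

End product_cons.

Fixpoint prod_measure k : ('I_k -> subprobability X R) ->
    subprobability (k.-tuple X) R :=
  match k with
  | 0 => fun=> dirac [tuple]
  | k'.+1 => fun nu =>
      prod_cons (nu ord0) (prod_measure (fun i => nu (lift ord0 i)))
  end.

Lemma prod_measureE k (nu : 'I_k -> subprobability X R) (A : 'I_k -> set X) :
  (forall i, measurable (A i)) ->
  prod_measure nu [set t | forall i, A i (tnth t i)] = (\prod_(i < k) nu i (A i))%E.
Proof.
elim: k nu A => [|k IHk] nu A mA /=.
  by rewrite big_ord0 diracE mem_set// => -[].
rewrite big_ord_recl /= -IHk//.
rewrite /prod_cons /pushforward /=.
rewrite (_ : _ @^-1` _ =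
  A ord0 `*` [set t | forall i, A (lift ord0 i) (tnth t i)]).
  rewrite product_measure1E//.
  rewrite (_ : [set t | _] =
      \bigcap_(i in [set: 'I_k]) ((@tnth k X)^~ i @^-1` A (lift ord0 i))).
    apply: fin_bigcap_measurable => // i _.
    by rewrite -[X in measurable X]setTI; exact: measurable_tnth.
  by apply/seteqP; split => [t tA i _|t tA i]; [exact: tA|exact: (tA i I)].
apply/seteqP; split => -[x t] /=.
  move=> xtA; split; first exact: (xtA ord0).
  by move=> i; have := xtA (lift ord0 i); rewrite tnthS.
move=> [xA tA] i; case: (unliftP ord0 i) => [j ->|-> //].
by rewrite tnthS.
Qed.

Definition power_measure k (mu : probability X R) :
    subprobability (k.-tuple X) R :=
  prod_measure (fun _ : 'I_k => mu : subprobability X R).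

Definition off_diagonal k : set (k.-tuple X) := [set u | uniq u].

(* Integral of f over D with respect to the product signed measure
   (nu - mu)(du_1) ... (nu - mu)(du_k), expanded by multilinearity over the set
   S of the coordinates that carry nu.  D need not be measurable: the library's
   integral is defined for every function. *)
Definition signed_integral k (nu : subprobability X R) (mu : probability X R)
    (D : set (k.-tuple X)) (f : k.-tuple X -> R) : R :=
  \sum_(S : {set 'I_k}) (-1) ^+ (k - #|S|) *
    \int[prod_measure
           (fun j => if j \in S then nu else (mu : subprobability X R))]_(u in D)
      f u.

Definition J (mu : probability X R) n (x : 'I_n -> X) k
    (f : k.-tuple X -> R) : R :=
  (n%:R `^ (k%:R / 2)) / k`!%:R *
  signed_integral (empirical x : subprobability X R) mu (@off_diagonal k) f.

Lemma J0 (mu : probability X R) n (x : 'I_n -> X) (f : 0.-tuple X -> R) :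
  J mu x f = f [tuple].
Proof.
rewrite /J mul0r powRr0 fact0 divr1 mul1r /signed_integral.
rewrite (bigD1 finset.set0)//= big1 ?addr0; last first.
  by move=> S; rewrite -cards_eq0 -leqn0 (leq_trans (max_card _))// card_ord.
rewrite cards0 subn0 expr0 mul1r.
rewrite (_ : @off_diagonal 0 = setT); last first.
  by apply/seteqP; split => // u _; rewrite /off_diagonal/= tuple0.
rewrite /Rintegral integral_dirac//=; first by rewrite indicE in_setT mul1r.
move=> _ Y _; rewrite setTI.
have [fY|fY] := pselect (Y (f [tuple])%:E).
  by rewrite (_ : _ @^-1` _ = setT)//; apply/seteqP; split => // u _ /=; rewrite tuple0.
by rewrite (_ : _ @^-1` _ = set0)//; apply/seteqP; split => // u /=; rewrite tuple0.
Qed.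

End measures.

Section diagrams.
Variables k1 k2 : nat.

(* Vertex v of a diagram is an index of type 'I_(k1 + k2); the edge (j, j')
   joins vertex j of the first row to the j'-th vertex of the second row, that
   is lshift k2 j to rshift k1 j'. *)
Definition edge : Type := ('I_k1 * 'I_k2)%type.

Definition is_diagram (N : {set edge}) : bool :=
  [forall e in N, forall e' in N,
    ((e.1 == e'.1) || (e.2 == e'.2)) ==> (e == e')].

(* A pair (N, N1): the edges in N1 have colour 1, those in N :\: N1 colour -1. *)
Definition coloured_diagrams (l p : nat) : {set {set edge} * {set edge}} :=
  [set B : {set edge} * {set edge} |
    [&& is_diagram B.1, B.2 \subset B.1, #|B.1| == l & #|B.2| == p]]%SET.

Variable B : {set edge} * {set edge}.

(* Index of the variable that replaces x_v once x_j has been substituted for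
   x_j' for every edge (j, j'). *)
Definition identify (v : 'I_(k1 + k2)) : 'I_(k1 + k2) :=
  if [pick e in B.1 | rshift k1 e.2 == v] is Some e then lshift k2 e.1 else v.

Definition integrated : {set 'I_(k1 + k2)} :=
  [set lshift k2 e.1 | e in B.2]%SET.

Definition remaining : {set 'I_(k1 + k2)} :=
  [set v | (identify v == v) && (v \notin integrated)]%SET.

Context d (X : measurableType d) (R : realType).

(* The variables with index in [remaining] take their values in y, those with
   index in [integrated] in z, both in increasing order of the indices.  The
   default [point] is not reached when the sizes match. *)
Definition variable_value m p (y : m.-tuple X) (z : p.-tuple X)
    (v : 'I_(k1 + k2)) : X :=
  if v \in integrated then nth point z (index v (enum integrated))
  else nth point y (index v (enum remaining)).

(* Equal to 0 at those y for which the integral does not exist or is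
   infinite. *)
Definition compose_diagram (mu : probability X R) (f : k1.-tuple X -> R)
    (g : k2.-tuple X -> R) (m p : nat) (y : m.-tuple X) : R :=
  \int[power_measure p mu]_z
    (f [tuple variable_value y z (identify (lshift k2 i)) | i < k1] *
     g [tuple variable_value y z (identify (rshift k1 j)) | j < k2]).

End diagrams.

Lemma card_integrated k1 k2 l p B : B \in coloured_diagrams k1 k2 l p ->
  #|integrated B| = p.
Proof.
rewrite inE => /and4P[/forall_inP dB sB _ /eqP <-].
rewrite card_in_imset// => e e' eB e'B /lshift_inj ee'.
have /forall_inP/(_ e' (fintype.subsetP sB _ e'B)) := dB e (fintype.subsetP sB _ eB).
by rewrite ee' eqxx => /eqP.
Qed.

Lemma card_remaining k1 k2 l p B : B \in coloured_diagrams k1 k2 l p ->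
  #|remaining B| = (k1 + k2 - l - p)%N.
Proof.
move=> dB; have := card_integrated dB; move: dB.
rewrite inE => /and4P[/forall_inP dB _ /eqP cB _] cI.
pose second := [set rshift k1 e.2 | e in B.1]%SET.
have cS : #|second| = l.
  rewrite -cB card_in_imset// => e e' eB e'B /rshift_inj ee'.
  have /forall_inP/(_ e' e'B) := dB e eB.
  by rewrite ee' eqxx orbT => /eqP.
have -> : remaining B = (~: (second :|: integrated B))%SET.
  apply/setP => v; rewrite !inE negb_or; congr (_ && _).
  rewrite /identify; case: pickP => [e /andP[eB /eqP ev]|noe].
    rewrite -ev eq_lrshift; apply/esym/negbTE; rewrite negbK.
    by apply/imsetP; exists e.
  rewrite eqxx; apply/esym/negP => /imsetP[e eB ve].
  by have := noe e; rewrite eB ve eqxx.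
have dis : (second :&: integrated B)%SET = finset.set0.
  apply/setP => v; rewrite !inE; apply/negP => /andP[/imsetP[e _ ->]].
  by move=> /imsetP[e' _ /esym/eqP]; rewrite eq_lrshift.
have cU : #|(second :|: integrated B)%SET| = (l + p)%N.
  by rewrite finset.cardsU dis cards0 subn0 cS cI.
by rewrite finset.cardsCs finset.setCK cU card_ord subnDA.
Qed.

Definition f_circ_g d (X : measurableType d) (R : realType)
    (mu : probability X R) k1 k2 (f : k1.-tuple X -> R) (g : k2.-tuple X -> R)
    (l p : nat) (y : (k1 + k2 - l - p).-tuple X) : R :=
  ((k1 - l)`! * (k2 - l)`! * (l - p)`! * p`!)%:R / (k1`! * k2`!)%:R *
  \sum_(B in coloured_diagrams k1 k2 l p) compose_diagram B mu f g p y.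

Arguments f_circ_g {d X R} mu {k1 k2} f g l p y.

Section iid.
Context d d' (Omega : measurableType d') (X : measurableType d) (R : realType).
Variables (P : probability Omega R) (n : nat) (xi : 'I_n -> {RV P >-> X}).

Definition independent_RVs : Prop :=
  forall (I : {set 'I_n}) (A : 'I_n -> set X),
    (forall i, measurable (A i)) ->
    P (\bigcap_(i in [set` I]) (xi i @^-1` A i)) =
    (\prod_(i in I) P (xi i @^-1` A i))%E.

Definition iid_with_distribution (mu : probability X R) : Prop :=
  independent_RVs /\
  forall i (A : set X), measurable A -> distribution P (xi i) A = mu A.

End iid.

(* Main.v *)
Require Import Defs.
From HB Require Import structures.
From mathcomp Require Import all_boot all_order all_algebra.
From mathcomp Require Import all_classical all_reals all_analysis.
From mathcomp Require Import measurable_realfun.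
From mathcomp Require Import ring lra.

Import Order.TTheory GRing.Theory Num.Theory.
Import numFieldNormedType.Exports.

Local Open Scope classical_set_scope.
Local Open Scope ring_scope.

(* The measure (mu_n - mu)^k restricted off the diagonals is a sum over the
   partial injections phi of the coordinates into the samples: the coordinate i
   is frozen at the sample phi i, with weight 1/n, or, if phi i is undefined, is
   integrated with respect to mu, with weight -1.  In the product of two such
   sums the pairs of coordinates frozen at the same sample form a diagram N.
   Each edge of N costs a factor 1/n, and N together with the assignment of the
   vertices that survive the identification determines the pair of partial
   injections.  On the side of the coloured diagrams, for a given N an edge
   whose vertex is integrated appears twice: with colour 1 (weight 1) and with
   colour -1 (weight -1).  These terms cancel, so that only the assignments
   which freeze all edges of N remain, and they are those of the product.
   Non-atomicity gives countable measurable partitions into cells of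
   arbitrarily small measure; almost surely the samples are separated by these
   partitions, which disposes of the diagonals, measurable or not. *)

Set Implicit Arguments.
Unset Strict Implicit.
Unset Printing Implicit Defensive.

(** * Families of independent variables with law mu *)

Section tuple_measures.
Context d (X : measurableType d) (R : realType).

Definition box k (A : 'I_k -> set X) : set (k.-tuple X) :=
  [set t | forall i, A i (tnth t i)].

Lemma measurable_box_family d' (T : measurableType d') (I : finType)
    (a : I -> T -> X) (A : I -> set X) :
  (forall i, measurable_fun setT (a i)) -> (forall i, measurable (A i)) ->
  measurable [set t | forall i, A i (a i t)].
Proof.
move=> ma mA.
rewrite (_ : [set t | _] = \bigcap_(i in [set: I]) (a i @^-1` A i)).
  apply: fin_bigcap_measurable => // i _.
  by rewrite -[X in measurable X]setTI; exact: ma.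
by apply/seteqP; split => [t tA i _|t tA i]; [exact: tA|exact: (tA i Logic.I)].
Qed.

Lemma measurable_box k (A : 'I_k -> set X) :
  (forall i, measurable (A i)) -> measurable (box A).
Proof.
by move=> mA; apply: (@measurable_box_family _ _ _ (fun i t => tnth t i)) => // i;
  exact: measurable_tnth.
Qed.

(** Boxes are stable under intersection and generate the product sigma-algebra, since the preimage
    of a set under one projection is a box with a single proper side. Finiteness of [m1] then gives
    uniqueness of the extension. *)
Lemma tuple_measure_ext k (m1 m2 : {measure set (k.-tuple X) -> \bar R}) :
  (m1 setT < +oo)%E ->
  (forall A : 'I_k -> set X, (forall i, measurable (A i)) ->
    m1 (box A) = m2 (box A)) ->
  forall B, measurable B -> m1 B = m2 B.
Proof.
move=> m1T m12.
pose G : set (set (k.-tuple X)) :=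
  [set B | exists2 A : 'I_k -> set X, (forall i, measurable (A i)) & B = box A].
have boxT : box (fun _ : 'I_k => setT) = setT by apply/seteqP; split.
apply: (@measure_unique _ _ _ G (fun=> setT)) => //.
- apply/seteqP; split.
    apply: sub_sigma_algebra2 => B.
    rewrite -bigcup_seq => -[i _] [A mA <-]; rewrite setTI.
    exists (fun j => if j == i then A else setT) => [j|].
      by case: ifP => // _; exact: measurableT.
    apply/seteqP; split => [t tA j|t /(_ i)]; last by rewrite eqxx.
    by case: eqP => // ->.
  apply: smallest_sub; first exact: sigma_algebra_measurable.
  by move=> _ [A mA ->]; exact: measurable_box.
- move=> _ _ [A mA ->] [B mB ->]; exists (fun i => A i `&` B i) => [i|].
    exact: measurableI.
  apply/seteqP; split => [t [tA tB] i|t tAB].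
    by split; [exact: tA|exact: tB].
  by split => i; have [] := tAB i.
- by move=> _; exists (fun=> setT) => // i; exact: measurableT.
- by rewrite bigcup_const//; exists 0%N.
- by move=> _ [A mA ->]; exact: m12.
Qed.

End tuple_measures.

Section iid_families.
Context d (X : measurableType d) (R : realType) (mu : probability X R).

(** One product formula encodes both independence and the common law: setting all but one side to
    [setT] recovers each marginal. The index is any finite type, so that families can be joined by
    sum types and reindexed. *)
Definition iid_family d' (T : measurableType d') (m : {measure set T -> \bar R})
    (I : finType) (a : I -> T -> X) :=
  (forall i, measurable_fun setT (a i)) /\
  forall A : I -> set X, (forall i, measurable (A i)) ->
    m [set t | forall i, A i (a i t)] = (\prod_i mu (A i))%E.

(** An index outside the image of [h] receives the whole space, which contributes a factor 1. This
    serves to select and to permute independent variables. *)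
Lemma iid_family_inj d' (T : measurableType d') (m : {measure set T -> \bar R})
    (I I' : finType) (h : I' -> I) (a : I -> T -> X) :
  injective h -> iid_family m a -> iid_family m (fun i => a (h i)).
Proof.
move=> hI [ma mA]; split=> [i|A mA']; first exact: ma.
pose A' i := if [pick i' | h i' == i] is Some i' then A i' else setT.
have A'h i : A' (h i) = A i.
  by rewrite /A'; case: pickP => [j /eqP /hI -> //|/(_ i)]; rewrite eqxx.
have mA'' i : measurable (A' i).
  by rewrite /A'; case: pickP => // _; exact: measurableT.
rewrite (_ : [set t | _] = [set t | forall i, A' i (a i t)]); last first.
  apply/seteqP; split => t /= tA i; last by have := tA (h i); rewrite A'h.
  by rewrite /A'; case: pickP => // i' /eqP <-.
rewrite mA// (bigID (mem [set h i | i in I']%SET))/= [X in (_ * X)%E]big1 ?mule1.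
  rewrite big_imset/=; last by move=> i j _ _ /hI.
  by apply: eq_big => [i|i _]; rewrite ?inE// A'h.
move=> i /imsetP Ni; rewrite /A'; case: pickP => [j /eqP hj|_].
  by case: Ni; exists j.
exact: probability_setT.
Qed.

Lemma iid_family_prod d1 d2 (T1 : measurableType d1) (T2 : measurableType d2)
    (m1 : subprobability T1 R) (m2 : subprobability T2 R) (I1 I2 : finType)
    (a1 : I1 -> T1 -> X) (a2 : I2 -> T2 -> X) :
  iid_family m1 a1 -> iid_family m2 a2 ->
  iid_family (m1 \x m2)%E (fun i t =>
    match i with inl i => a1 i t.1 | inr i => a2 i t.2 end).
Proof.
move=> [ma1 iid1] [ma2 iid2]; split=> [[] i|A mA].
- by apply: measurableT_comp => //; exact: measurable_fst.
- by apply: measurableT_comp => //; exact: measurable_snd.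
rewrite (_ : [set t | _] = [set t | forall i, A (inl i) (a1 i t)] `*`
    [set t | forall i, A (inr i) (a2 i t)]); last first.
  apply/seteqP; split => t /= tA; first by split => i;
    [exact: (tA (inl i))|exact: (tA (inr i))].
  by case: tA => tA1 tA2 [] i.
rewrite big_sumType/= -iid1// -iid2//.
rewrite -[LHS]/((m1 \x m2)%E _) product_measure1E//.
- apply: (measurable_box_family (A := fun i => A (inl i)) ma1) => i; exact: mA.
- apply: (measurable_box_family (A := fun i => A (inr i)) ma2) => i; exact: mA.
Qed.

Lemma iid_family_tnth k :
  iid_family (power_measure k mu) (fun (i : 'I_k) t => tnth t i).
Proof.
by split=> [i|A mA]; [exact: measurable_tnth|exact: prod_measureE].
Qed.

Lemma iid_family_RVs d' (Omega : measurableType d') (P : probability Omega R) n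
    (xi : 'I_n -> {RV P >-> X}) :
  iid_with_distribution xi mu -> iid_family P (fun i w => xi i w).
Proof.
move=> [ind dist]; split=> // A mA.
rewrite (_ : [set t | _] =
    \bigcap_(i in [set` [set: 'I_n]%SET]) (xi i @^-1` A i)).
  rewrite [LHS](ind [set: 'I_n]%SET A mA); apply: eq_big => [i|i _]; first by rewrite inE.
  by rewrite -(dist i).
by apply/seteqP; split => [t tA i _|t tA i]; [exact: tA|apply: tA; rewrite /= inE].
Qed.

Lemma power_measure_setT k : power_measure k mu setT = 1%E.
Proof.
have [_ /(_ (fun=> setT) (fun=> measurableT))] := iid_family_tnth k.
rewrite big1 => [<-|i _]; last exact: probability_setT.
by congr (power_measure _ _ _); apply/seteqP; split.
Qed.

Section law_transfer.
Context d' (T : measurableType d') (m : {measure set T -> \bar R}).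
Variables (k : nat) (a : 'I_k -> T -> X).
Hypothesis iida : iid_family m a.

Let F t : k.-tuple X := [tuple a i t | i < k].

Lemma measurable_mktuple : measurable_fun setT F.
Proof.
apply/measurable_fun_tnthP => i; have [ma _] := iida.
by rewrite (_ : _ \o _ = a i)//; apply/funext => t; rewrite /= tnth_mktuple.
Qed.

(** Change of variables: the image of [m] under the tuple of the [a i] agrees with the power of [mu]
    on boxes, hence on all measurable sets. *)
Lemma iid_ge0_integral (f : k.-tuple X -> \bar R) :
  measurable_fun [set: k.-tuple X] f -> (forall u, 0 <= f u)%E ->
  (\int[m]_t f [tuple a i t | i < k] = \int[power_measure k mu]_u f u)%E.
Proof.
move=> mf f0.
have := ge0_integral_pushforward measurable_mktuple m measurableT mf.
move=> /(_ (fun u _ => f0 u)) E.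
rewrite -[LHS]E.
apply: (eq_measure_integral (power_measure k mu)).
  exact: measurable_mktuple.
move=> mF A mA _; apply/esym; apply: tuple_measure_ext => //=.
  by rewrite power_measure_setT ltry.
move=> {A mA} A mA; have [_ /(_ _ mA) ->] := iid_family_tnth k.
have [_ /(_ _ mA) <-] := iida; congr (m _).
by apply/seteqP; split => t /= tA i; have := tA i; rewrite tnth_mktuple.
Qed.

Lemma iid_integrable (f : k.-tuple X -> \bar R) :
  (power_measure k mu).-integrable setT f ->
  m.-integrable setT (fun t => f [tuple a i t | i < k]).
Proof.
move=> /integrableP[mf foo]; apply/integrableP; split.
  by apply: measurableT_comp => //; exact: measurable_mktuple.
rewrite (iid_ge0_integral (f := fun u => `|f u|%E))//.
exact: measurableT_comp.
Qed.

Lemma iid_integral (f : k.-tuple X -> \bar R) :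
  measurable_fun [set: k.-tuple X] f ->
  (\int[m]_t f [tuple a i t | i < k] = \int[power_measure k mu]_u f u)%E.
Proof.
move=> mf; rewrite [LHS]integralE [RHS]integralE; congr (_ - _)%E.
- rewrite -iid_ge0_integral; [|exact: measurable_funepos|by []].
  by apply: eq_integral => t _; rewrite !funeposE.
- rewrite -iid_ge0_integral; [|exact: measurable_funeneg|by []].
  by apply: eq_integral => t _; rewrite !funenegE.
Qed.

End law_transfer.

End iid_families.

(** * Small cells *)

Section small_cells.
Context d (X : measurableType d) (R : realType) (mu : probability X R).

Let M A := fine (mu A).

Let ME A : measurable A -> mu A = (M A)%:E.
Proof. by move=> mA; rewrite fineK// fin_num_measure. Qed.

Let le_M A B : measurable A -> measurable B -> A `<=` B -> M A <= M B.
Proof.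
by move=> mA mB AB; rewrite -lee_fin -(ME mA) -(ME mB) le_measure ?inE.
Qed.

Let MU A B : measurable A -> measurable B -> A `&` B = set0 ->
  M (A `|` B) = M A + M B.
Proof.
move=> mA mB AB; apply: EFin_inj; rewrite EFinD -(ME mA) -(ME mB) -ME ?measureU//.
exact: measurableU.
Qed.

Hypothesis mu_na : non_atomic mu.

(** Non-atomicity splits A into two pieces of positive measure, and one of them has at most half of
    the mass. *)
Lemma non_atomic_half A : measurable A -> (0 < mu A)%E ->
  exists B, [/\ measurable B, B `<=` A, (0 < mu B)%E & M B <= M A / 2].
Proof.
move=> mA A0; have [B [mB BA B0' BltA']] := mu_na mA A0.
have {B0'}B0 : (0 < mu B)%E by [].
have {BltA'}BltA : (mu B < mu A)%E by [].
have mAB : measurable (A `\` B) by exact: measurableD.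
have E : M A = M B + M (A `\` B).
  rewrite -MU//; last by rewrite setDIK.
  by rewrite setDUK.
have [BA2|BA2] := leP (M B) (M A / 2); first by exists B.
exists (A `\` B); split => //.
  by move: BltA; rewrite (ME mA) (ME mB) (ME mAB) !lte_fin E ltrDl.
by rewrite -(lerD2l (M B)) -E {1}(splitr (M A)) lerD2r ltW.
Qed.

Lemma non_atomic_small (e : R) A : 0 < e -> measurable A -> (0 < mu A)%E ->
  exists B, [/\ measurable B, B `<=` A, (0 < mu B)%E & (mu B <= e%:E)%E].
Proof.
move=> e0 mA A0.
have [k ke] : exists k : nat, M A / 2 ^+ k <= e.
  have : (fun k : nat => M A * 2^-1 ^+ k) @ \oo --> M A * 0.
    apply: cvgM; first exact: cvg_cst.
    by apply: cvg_expr; rewrite ger0_norm ?invr_ge0// invf_lt1 ?ltr1n.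
  rewrite mulr0 => /cvgr_le/(_ _ e0)[k _ /(_ k (leqnn _)) ke]; exists k.
  by rewrite -exprVn.
suff [B [mB BA B0 Bk]] : exists B,
    [/\ measurable B, B `<=` A, (0 < mu B)%E & M B <= M A / 2 ^+ k].
  by exists B; split=> //; rewrite ME// lee_fin (le_trans Bk).
elim: k {ke} => [|k [B [mB BA B0 Bk]]].
  by exists A; split=> //; rewrite expr0 divr1.
have [C [mC CB C0 Ck]] := non_atomic_half mB B0.
exists C; split => //; first exact: subset_trans BA.
by rewrite (le_trans Ck)// exprSr invfM mulrA ler_pM2r ?invr_gt0.
Qed.

(** Exhaustion: among the countable unions of small sets one has maximal measure. If its complement
    had positive measure, it would contain a further small set of positive measure; so the
    complement is null, and is itself small. *)
Lemma non_atomic_cover (e : R) : 0 < e -> exists C : nat -> set X,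
  (forall i, measurable (C i) /\ (mu (C i) <= e%:E)%E) /\ \bigcup_i C i = setT.
Proof.
move=> e0.
pose small (A : set X) := measurable A /\ (mu A <= e%:E)%E.
pose K (A : set X) := exists2 C : nat -> set X,
  (forall i, small (C i)) & A = \bigcup_i C i.
have KU (A : nat -> set X) : (forall n, K (A n)) -> K (\bigcup_n A n).
  move=> KA.
  have /choice[C hC] : forall n, exists C : nat -> set X,
      (forall i, small (C i)) /\ A n = \bigcup_i C i.
    by move=> n; have [C] := KA n; exists C.
  (* A countable union of countable families is reindexed by codes of pairs; a number that codes no
     pair is given the empty set. *)
  exists (fun m => if (unpickle m : option (nat * nat)) is Some (n, i)
                   then C n i else set0).
    move=> m; case: unpickle => [[n i]|]; first by have [] := hC n.
    by split; [exact: measurable0|rewrite measure0 lee_fin ltW].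
  apply/seteqP; split => x /=.
    move=> [n _]; have [_ ->] := hC n => -[i _ Cx].
    by exists (pickle (n, i)) => //; rewrite pickleK.
  move=> [m _]; case: unpickle => [[n i]|] // Cx.
  by exists n => //; have [_ ->] := hC n; exists i.
have K1 A : small A -> K A.
  by move=> sA; exists (fun=> A) => //; rewrite bigcup_const//; exists 0%N.
have KU2 A B : K A -> K B -> K (A `|` B).
  move=> KA KB; rewrite -bigcup2E; apply: KU => -[//|[//|n]] /=.
  by apply: K1; split; [exact: measurable0|rewrite measure0 lee_fin ltW].
have mK A : K A -> measurable A.
  by move=> [C sC ->]; apply: bigcupT_measurable => i; have [] := sC i.
pose E := M @` K.
have M1 A : measurable A -> M A <= 1.
  by move=> mA; rewrite -lee_fin -ME// probability_le1.
have supE : has_sup E.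
  split; last by exists 1 => _ [A /mK mA <-]; exact: M1.
  exists (M set0); exists set0 => //; apply: K1; split.
    exact: measurable0.
  by rewrite measure0 lee_fin ltW.
have /choice[A hA] : forall n, exists A, K A /\ sup E - n.+1%:R^-1 < M A.
  move=> n; have n0 : 0 < n.+1%:R^-1 :> R by rewrite invr_gt0.
  by have [_ [A KA <-] AE] := sup_adherent n0 supE; exists A.
have KUA : K (\bigcup_n A n) by apply: KU => n; have [] := hA n.
have mUA := mK _ KUA.
suff N0 : mu (~` \bigcup_n A n) = 0%E.
  have : K (\bigcup_n A n `|` ~` \bigcup_n A n).
    apply: KU2 => //; apply: K1; split; first exact: measurableC.
    by rewrite N0 lee_fin ltW.
  by rewrite setUv => -[C sC ->]; exists C.
apply/eqP; rewrite eq_le measure_ge0 andbT leNgt; apply/negP => N0.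
have [B [mB BN B0 Be]] := non_atomic_small e0 (measurableC mUA) N0.
have MB0 : 0 < M B by rewrite -lte_fin -ME.
have [k] := ltr_add_invr MB0; rewrite add0r => kB.
have [_ Ak] := hA k.
have : M (\bigcup_n A n `|` B) <= sup E.
  by apply: (ub_le_sup (proj2 supE)); eexists => //; apply: KU2 => //; exact: K1.
rewrite MU//; last first.
  by apply/disjoints_subset => x xA /BN.
apply/negP; rewrite -ltNge.
(* [A k] misses the supremum by less than 1/(k+1), and B has measure more than 1/(k+1), so that
   adding B to the union exceeds the supremum. *)
rewrite -(subrK k.+1%:R^-1 (sup E)) ltrD//.
apply: lt_le_trans Ak _; apply: le_M => //; first by apply: mK; have [] := hA k.
exact: bigcup_sup.
Qed.

(* [c m] labels the cells of the m-th of a sequence of countable measurable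
   partitions whose cells have measure at most 1/(m+1). *)
Definition is_cells (c : nat -> X -> nat) := forall m i,
  measurable (c m @^-1` [set i]) /\ (mu (c m @^-1` [set i]) <= (m.+1%:R^-1)%:E)%E.

Lemma exists_cells : exists c, is_cells c.
Proof.
suff /choice[c hc] : forall m, exists c : X -> nat, forall i,
    measurable (c @^-1` [set i]) /\ (mu (c @^-1` [set i]) <= (m.+1%:R^-1)%:E)%E.
  by exists c.
move=> m; have m0 : 0 < m.+1%:R^-1 :> R by rewrite invr_gt0.
have [C [sC CT]] := non_atomic_cover m0.
have ex x : exists i, x \in C i.
  have : (\bigcup_i C i) x by rewrite CT.
  by move=> [i _ Cx]; exists i; rewrite inE.
(* Labelling a point by the first member of the cover that contains it makes the cover a
   partition. *)
exists (fun x => ex_minn (ex x)) => i.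
have E : (fun x => ex_minn (ex x)) @^-1` [set i] = seqDU C i.
  apply/seteqP; split => x /=.
    case: ex_minnP => j; rewrite inE => Cj jmin <-; split => //.
    rewrite -bigcup_mkord => -[l /= lj Cl].
    by have := jmin l; rewrite inE leqNgt lj => /(_ Cl).
  case: ex_minnP => j; rewrite inE => Cj jmin [Ci NC].
  apply/eqP; rewrite eqn_leq jmin ?inE//= leqNgt; apply/negP => ji.
  by apply: NC; rewrite -bigcup_mkord; exists j.
have mE : measurable (seqDU C i).
  apply: measurableD; first by have [] := sC i.
  by apply: bigsetU_measurable => j _; have [] := sC j.
rewrite E; split=> //; have [mC Cm] := sC i.
by apply: le_trans Cm; apply: le_measure; rewrite ?inE//; exact: subDsetl.
Qed.

(** A measurable substitute for equality: it contains the diagonal, which may fail to be measurable,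
    and is still negligible for independent variables. *)
Definition same_cells (c : nat -> X -> nat) (x y : X) := forall m, c m x = c m y.

Variable c : nat -> X -> nat.
Hypothesis cP : is_cells c.

Section same.
Context d' (T : measurableType d') (m : {measure set T -> \bar R}).

Lemma measurable_same_cells (a b : T -> X) :
  measurable_fun setT a -> measurable_fun setT b ->
  measurable [set t | same_cells c (a t) (b t)].
Proof.
move=> ma mb.
rewrite (_ : [set t | _] = \bigcap_m \bigcup_i
  (a @^-1` (c m @^-1` [set i]) `&` b @^-1` (c m @^-1` [set i]))).
  apply: bigcapT_measurable => n; apply: bigcupT_measurable => i.
  by apply: measurableI; rewrite -[X in measurable X]setTI;
    [apply: ma|apply: mb] => //; have [] := cP n i.
apply/seteqP; split => t /= tab n; first by move=> _; exists (c n (a t)).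
by have [i _ [/= -> ->]] := tab n Logic.I.
Qed.

(** For every n the event lies in the preimage of the cell of x in the n-th partition, of measure at
    most 1/(n+1). *)
Lemma null_same_cells1 (x : X) (a : T -> X) :
  measurable_fun setT a ->
  (forall A, measurable A -> m (a @^-1` A) = mu A) ->
  m [set t | same_cells c x (a t)] = 0%E.
Proof.
move=> ma mA.
have mS := measurable_same_cells (measurable_cst x) ma.
apply/eqP; rewrite eq_le measure_ge0 andbT; apply/lee_addgt0Pr => e e0.
have [n] := ltr_add_invr e0; rewrite !add0r => /ltW ne.
have [mc cn] := cP n (c n x).
rewrite (le_trans _ (_ : (n.+1%:R^-1)%:E <= e%:E)%E)// (le_trans _ cn)//.
rewrite -mA//; apply: le_measure; rewrite ?inE//.
  by rewrite -[X in measurable X]setTI; exact: ma.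
Qed.

(** For every n the event lies in the union over the cells C of the n-th partition of the events
    that both variables fall in C. Its measure is at most the sum of mu(C)^2, hence at most 1/(n+1)
    times the sum of mu(C), which is 1. *)
Lemma null_same_cells2 (a b : T -> X) :
  measurable_fun setT a -> measurable_fun setT b ->
  (forall A B, measurable A -> measurable B ->
    m (a @^-1` A `&` b @^-1` B) = (mu A * mu B)%E) ->
  m [set t | same_cells c (a t) (b t)] = 0%E.
Proof.
move=> ma mb mAB.
have mS := measurable_same_cells ma mb.
apply/eqP; rewrite eq_le measure_ge0 andbT; apply/lee_addgt0Pr => e e0.
have [n] := ltr_add_invr e0; rewrite !add0r => /ltW ne.
pose C i := c n @^-1` [set i].
have mC i : measurable (C i) by have [] := cP n i.
pose D i := a @^-1` C i `&` b @^-1` C i.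
have mD i : measurable (D i).
  by apply: measurableI; rewrite -[X in measurable X]setTI; [exact: ma|exact: mb].
have tC (A : Type) (f : A -> X) : trivIset setT (fun i => f @^-1` C i).
  by apply/trivIsetP => i j _ _ ij; apply/seteqP; split => // t [/= ti tj];
    case/eqP: ij; rewrite -ti -tj.
have tD : trivIset setT D by apply: trivIset_setIl; exact: tC.
apply: (@le_trans _ _ (m (\bigcup_i D i))).
  apply: le_measure; rewrite ?inE//; first exact: bigcupT_measurable.
  by move=> t /= /(_ n) tn; exists (c n (a t)).
rewrite measure_bigcup//.
apply: (@le_trans _ _ (\sum_(0 <= i <oo) (n.+1%:R^-1)%:E * mu (C i))%E).
  rewrite [leLHS](eq_eseriesl (Q := xpredT)); last by move=> i; rewrite in_setT.
  apply: lee_nneseries => // i _; rewrite mAB//.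
  by apply: lee_wpmul2r => //; have [] := cP n i.
rewrite nneseriesZl//.
have -> : (\sum_(0 <= i <oo) mu (C i) = mu setT)%E.
  transitivity (mu (\bigcup_i C i)).
    rewrite measure_bigcup//; last exact: (tC _ id).
    by apply: eq_eseriesl => i; rewrite in_setT.
  by congr (mu _); apply/seteqP; split => // x _; exists (c n x).
by rewrite probability_setT mule1 lee_fin.
Qed.

Lemma iid_same_cells1 (I : finType) (a : I -> T -> X) x i :
  iid_family mu m a -> m [set t | same_cells c x (a i t)] = 0%E.
Proof.
move=> iida; apply: null_same_cells1 => [|A mA]; first exact: (proj1 iida).
have [_ /(_ (fun=> A) (fun=> mA))] := iid_family_inj (h := fun _ : unit => i)
  (fun x y _ => match x, y with tt, tt => erefl end) iida.
rewrite big_const card_unit/= mule1 => <-; congr (m _).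
by apply/seteqP; split => [t tA []|t /(_ tt)].
Qed.

Lemma iid_same_cells2 (I : finType) (a : I -> T -> X) i j :
  i != j -> iid_family mu m a -> m [set t | same_cells c (a i t) (a j t)] = 0%E.
Proof.
move=> ij iida; apply: null_same_cells2; [exact: (proj1 iida)..|].
move=> A B mA mB.
have hI : injective (fun b : bool => if b then i else j).
  by move=> [] [] // /eqP; rewrite ?(negbTE ij)// eq_sym (negbTE ij).
have [_ /(_ (fun b => if b then A else B))] := iid_family_inj hI iida.
rewrite big_bool => <-; last by case.
congr (m _); apply/seteqP; split => [t [At Bt] []//|t tAB].
by split; [exact: (tAB true)|exact: (tAB false)].
Qed.

End same.

End small_cells.

(** * Freezing coordinates at the samples *)

Section substitution.
Variables (n : nat).

Definition subst (X : Type) k (x : 'I_n -> X) (phi : 'I_k -> option 'I_n)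
    (u : k.-tuple X) : k.-tuple X :=
  [tuple if phi i is Some j then x j else tnth u i | i < k].

(** Injectivity on the domain of definition: [None] may be taken several times. *)
Definition pinjective (I : finType) (phi : I -> option 'I_n) : bool :=
  [forall i, forall j, (phi i != None) && (phi i == phi j) ==> (i == j)].

Lemma pinjectiveP (I : finType) (phi : I -> option 'I_n) :
  reflect (forall i j a, phi i = Some a -> phi j = Some a -> i = j)
    (pinjective phi).
Proof.
apply: (iffP forallP) => [phiI i j a ia ja|phiI i].
  by apply/eqP; have /forallP/(_ j) := phiI i; rewrite ia ja eqxx.
apply/forallP => j; apply/implyP => /andP[].
by case E: (phi i) => [a|]// _ /eqP/esym ja; apply/eqP/(phiI _ _ a).
Qed.

Variables (d : _) (X : measurableType d) (R : realType).

Lemma measurable_subst k (x : 'I_n -> X) (phi : 'I_k -> option 'I_n) :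
  measurable_fun setT (subst x phi).
Proof.
apply/measurable_fun_tnthP => i.
rewrite (_ : _ \o _ = fun u => if phi i is Some j then x j else tnth u i).
  by case: (phi i) => [j|]; [exact: measurable_cst|exact: measurable_tnth].
by apply/funext => u; rewrite /= tnth_mktuple.
Qed.

Variable mu : probability X R.

(** Since [phi] is injective where defined, the k places are filled by distinct members of one
    independent family on the product of Omega and X^k, made of the samples and the free
    coordinates. Integrability passes to that product, and Fubini gives it for almost every
    section. *)
Lemma ae_integrable_subst k d' (Omega : measurableType d')
    (P : probability Omega R) (xi : 'I_n -> Omega -> X)
    (phi : 'I_k -> option 'I_n) (F : k.-tuple X -> \bar R) :
  iid_family mu P xi -> pinjective phi ->
  (power_measure k mu).-integrable setT F ->
  {ae P, forall w, (power_measure k mu).-integrable setT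
    (fun u => F (subst (xi^~ w) phi u))}.
Proof.
move=> iidxi /pinjectiveP phiI iF.
(* [h i] is the variable that fills the place i: a sample or the free coordinate itself. *)
pose h i : 'I_n + 'I_k := if phi i is Some j then inl j else inr i.
have hI : injective h.
  move=> i j; rewrite /h; case Ei: (phi i) => [a|]; case Ej: (phi j) => [b|] // [] //.
  by move=> ab; apply: (phiI _ _ a) => //; rewrite ab.
have iidh := iid_family_inj hI (iid_family_prod iidxi (iid_family_tnth mu k)).
have := ae_integrable1 (iid_integrable iidh iF).
apply: filterS => w; congr (integrable _ _ _); apply/funext => u.
congr F; apply: eq_from_tnth => i; rewrite !tnth_mktuple /h.
by case: (phi i).
Qed.

Section cells.
Variables (c : nat -> X -> nat) (k : nat).
Hypothesis cP : is_cells mu c.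

Definition separated : set (k.-tuple X) :=
  [set u | forall i j, i != j -> ~ same_cells c (tnth u i) (tnth u j)].

Lemma measurable_separated : measurable separated.
Proof.
rewrite (_ : separated = \bigcap_(p in [set p : 'I_k * 'I_k | p.1 != p.2])
    ~` [set u | same_cells c (tnth u p.1) (tnth u p.2)]).
  apply: fin_bigcap_measurable; first exact: finite_finset.
  move=> p _; apply: measurableC.
  by apply: (measurable_same_cells cP); exact: measurable_tnth.
apply/seteqP; split => [u su [i j] /= ij|u su i j ij]; first exact: su.
exact: (su (i, j)).
Qed.

Lemma separated_off_diagonal : separated `<=` @off_diagonal _ X k.
Proof.
move=> u su; apply/tuple_uniqP => i j uij; apply/eqP; apply: contraT => ij.
by case: (su _ _ ij) => m; rewrite uij.
Qed.

(** Two distinct places hold either two distinct samples, separated by assumption, or a sample and a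
    free coordinate, or two free coordinates; the last two cases are the two null events above. *)
Lemma null_subst_separated (x : 'I_n -> X) (phi : 'I_k -> option 'I_n) :
  (forall i j, i != j -> ~ same_cells c (x i) (x j)) -> pinjective phi ->
  {ae power_measure k mu, forall u, separated (subst x phi u)}.
Proof.
move=> xs /pinjectiveP phiI.
have null (S : set (k.-tuple X)) : measurable S -> power_measure k mu S = 0%E ->
    {ae power_measure k mu, forall u, ~ S u}.
  by move=> mS S0; exists S; split => // u /contrapT.
apply: filter_forall => i; apply: filter_forall => j.
have [->|ij] := eqVneq i j; first by apply: nearW => u /eqP.
have mi (i : 'I_k) := @measurable_tnth _ X k i.
pose E u := same_cells c (tnth (subst x phi u) i) (tnth (subst x phi u) j).
suff : {ae power_measure k mu, forall u, ~ E u} by apply: filterS => u Eu _.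
rewrite /E.
have E1 u : (tnth (subst x phi u) i) = if phi i is Some a then x a else tnth u i.
  by rewrite tnth_mktuple.
have E2 u : (tnth (subst x phi u) j) = if phi j is Some a then x a else tnth u j.
  by rewrite tnth_mktuple.
suff : {ae power_measure k mu, forall u, ~ same_cells c
    (if phi i is Some a then x a else tnth u i)
    (if phi j is Some b then x b else tnth u j)}.
  by apply: filterS => u; rewrite -E1 -E2.
case Ei: (phi i) => [a|]; case Ej: (phi j) => [b|].
- apply: nearW => u; apply: xs; apply/eqP => ab.
  by move/eqP: ij; apply; apply: (phiI _ _ a) => //; rewrite ab.
- apply: null; first exact: (measurable_same_cells cP).
  exact: (iid_same_cells1 cP (x a) j (iid_family_tnth mu k)).
- have sC u : same_cells c (tnth u i) (x b) -> same_cells c (x b) (tnth u i).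
    by move=> h m; rewrite h.
  suff : {ae power_measure k mu, forall u, ~ same_cells c (x b) (tnth u i)}.
    by apply: filterS => u h /sC.
  apply: null; first exact: (measurable_same_cells cP).
  exact: (iid_same_cells1 cP (x b) i (iid_family_tnth mu k)).
- apply: null; first exact: (measurable_same_cells cP).
  exact: (iid_same_cells2 cP ij (iid_family_tnth mu k)).
Qed.

End cells.
End substitution.

Lemma big_option (V : Type) (idx : V) (op : Monoid.com_law idx) (I : finType)
    (F : option I -> V) :
  \big[op/idx]_o F o = op (F None) (\big[op/idx]_i F (Some i)).
Proof.
rewrite (bigD1 None)//=; congr (op _ _).
by rewrite (@reindex_omap _ _ _ _ _ Some id)/=; [apply: eq_bigl => i; rewrite eqxx|case].
Qed.

(** * Mixed products of the empirical measure and mu as mixtures of frozen laws *)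

Section expansion.
Context d (X : measurableType d) (R : realType) (mu : probability X R).
Variables (n : nat) (x : 'I_n -> X) (k : nat).

Definition mixed_measure (S : {set 'I_k}) : subprobability (k.-tuple X) R :=
  prod_measure (fun j => if j \in S then (empirical R x : subprobability X R)
    else (mu : subprobability X R)).

(** The coefficient of the law of [subst x phi u] in [mixed_measure S]: it vanishes unless [phi] is
    defined exactly on S, and is then n^(-|S|). *)
Definition mixed_weight (S : {set 'I_k}) (phi : 'I_k -> option 'I_n) : R :=
  \prod_i (if i \in S then (phi i != None)%:R * n%:R^-1 else (phi i == None)%:R).

Lemma mixed_weight_ge0 S phi : 0 <= mixed_weight S phi.
Proof.
by apply: prodr_ge0 => i _; case: ifP.
Qed.

Let law phi : {measure set (k.-tuple X) -> \bar R} :=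
  measure_function_pushforward__canonical__measure_function_Measure
    (power_measure k mu) (measurable_subst x phi).

Let term S (phi : {ffun 'I_k -> option 'I_n}) : {measure set (k.-tuple X) -> \bar R} :=
  mscale (NngNum (mixed_weight_ge0 S phi)) (law phi).

Let phis := enum {ffun 'I_k -> option 'I_n}.

(** [msum] runs over natural numbers, hence the enumeration of the assignments; the default of [nth]
    is never reached below [size phis]. *)
Let total S : {measure set (k.-tuple X) -> \bar R} :=
  msum (fun l => term S (nth [ffun=> None] phis l)) (size phis).

Let sum_phis (F : {ffun 'I_k -> option 'I_n} -> \bar R) :
  (\sum_(l < size phis) F (nth [ffun=> None] phis l) = \sum_phi F phi)%E.
Proof. by rewrite -[RHS]big_enum/= (big_nth [ffun=> None]) big_mkord. Qed.

Let law_box phi (A : 'I_k -> set X) : (forall i, measurable (A i)) ->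
  law phi (box A) =
  (\prod_i if phi i is Some j then (x j \in A i)%:R else fine (mu (A i)))%:E.
Proof.
move=> mA.
pose A' i := if phi i is Some j then (if x j \in A i then setT else set0) else A i.
have mA' i : measurable (A' i).
  by rewrite /A'; case: (phi i) => [j|//]; case: ifP.
have [_ /(_ A' mA') E] := iid_family_tnth mu k.
transitivity (\prod_i mu (A' i))%E.
  rewrite -E; congr (power_measure k mu _).
  apply/seteqP; split => u /= uA i; have := uA i; rewrite tnth_mktuple /A';
    case: (phi i) => [j|] //.
  - by move=> xA; rewrite mem_set.
  - by case: ifPn => //; rewrite inE.
rewrite -prodEFin; apply: eq_bigr => i _; rewrite /A'.
case: (phi i) => [j|]; last by rewrite fineK// fin_num_measure.
by case: ifP; rewrite ?probability_setT ?measure0.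
Qed.

Let mixed_box S (A : 'I_k -> set X) : (forall i, measurable (A i)) ->
  mixed_measure S (box A) = total S (box A).
Proof.
move=> mA; apply/esym.
apply: (etrans (sum_phis (fun phi => term S phi (box A)))); apply/esym.
transitivity (\sum_(phi : {ffun 'I_k -> option 'I_n})
  (mixed_weight S phi)%:E * law phi (box A))%E; last by [].
under eq_bigr do rewrite law_box// -EFinM /mixed_weight -big_split/=.
rewrite sumEFin.
(* [e i o] is the contribution of the coordinate i with value o. The sum over o is the empirical
   measure of [A i] (terms [Some j]) or mu of [A i] (term [None]), and distributing the product over
   i gives the sum over [phi]. *)
pose e i (o : option 'I_n) : R := (if i \in S then (o != None)%:R * n%:R^-1
  else (o == None)%:R) *
  if o is Some j then (x j \in A i)%:R else fine (mu (A i)).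
rewrite -(bigA_distr_bigA e)/= -prodEFin.
transitivity (\prod_(i < k) (if i \in S then
    (empirical R x : subprobability X R) else (mu : subprobability X R)) (A i))%E.
  exact: prod_measureE.
apply: eq_bigr => i _; rewrite big_option /e/=.
case: ifP => _.
  rewrite !mul0r add0r /= /empirical -sum1_card natr_sum mulr_sumr.
  congr EFin; rewrite big_mkcond/=; apply: eq_bigr => j _.
  by rewrite mul1r inE; case: (x j \in A i); rewrite ?mulr0.
rewrite mul1r big1 ?addr0; last by move=> j _; rewrite mul0r.
by rewrite fineK// fin_num_measure.
Qed.

Lemma mixed_ge0_integral S (F : k.-tuple X -> \bar R) :
  measurable_fun [set: k.-tuple X] F -> (forall u, 0 <= F u)%E ->
  (\int[mixed_measure S]_u F u =
   \sum_(phi : {ffun 'I_k -> option 'I_n}) (mixed_weight S phi)%:E *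
     \int[power_measure k mu]_u F (subst x phi u))%E.
Proof.
move=> mF F0; transitivity (\int[total S]_u F u)%E.
  apply: (eq_measure_integral (total S)) => A mA _.
  apply: tuple_measure_ext => // [|{mA}A mA]; last exact: mixed_box.
  by rewrite ltey_eq fin_num_measure.
rewrite ge0_integral_measure_sum//.
apply: (etrans (sum_phis (fun phi => \int[term S phi]_u F u)%E)).
apply: eq_bigr => phi _; rewrite ge0_integral_mscale//; congr (_ * _)%E.
have := ge0_integral_pushforward (measurable_subst x phi)
  (power_measure k mu) measurableT mF.
by apply => u _; exact: F0.
Qed.

End expansion.

(** * Expansion of the signed integral *)

Section off_diagonal_expansion.
Context d (X : measurableType d) (R : realType) (mu : probability X R).
Variables (n : nat) (x : 'I_n -> X) (k : nat) (c : nat -> X -> nat).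
Hypothesis cP : is_cells mu c.
Hypothesis xs : forall i j, i != j -> ~ same_cells c (x i) (x j).

Import HBNNSimple.

Let subst_diagonal (phi : 'I_k -> option 'I_n) u :
  ~~ pinjective phi -> ~ (@off_diagonal _ X k) (subst x phi u).
Proof.
move=> /pinjectiveP phiNI /tuple_uniqP sI; apply: phiNI => i j a ia ja.
by apply: sI; rewrite !tnth_mktuple ia ja.
Qed.

(* [off_diagonal] need not be measurable, hence the left-hand side is a supremum
   over simple functions h <= F \_ off_diagonal: h vanishes at the points frozen
   by a non-injective phi, and [separated] is a measurable subset of
   [off_diagonal] that is conegligible for the injective ones. *)
Lemma off_diagonal_ge0_integral S (F : k.-tuple X -> \bar R) :
  measurable_fun [set: k.-tuple X] F -> (forall u, 0 <= F u)%E ->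
  (\int[mixed_measure mu x S]_(u in @off_diagonal _ X k) F u =
   \sum_(phi : {ffun 'I_k -> option 'I_n} | pinjective phi)
     (mixed_weight R S phi)%:E *
     \int[power_measure k mu]_u F (subst x phi u))%E.
Proof.
move=> mF F0.
have msub phi : measurable_fun setT (fun u => F (subst x phi u)).
  by apply: measurableT_comp => //; exact: measurable_subst.
have w0 phi : (0 <= (mixed_weight R S phi)%:E)%E.
  by rewrite lee_fin mixed_weight_ge0.
have D0 u : (0 <= (F \_ (@off_diagonal _ X k)) u)%E.
  by rewrite /patch; case: ifP.
apply/eqP; rewrite eq_le; apply/andP; split.
  rewrite ge0_integralE//; apply: ge_ereal_sup => _ [h /= hF <-].
  have mh : measurable_fun [set: k.-tuple X] (EFin \o h).
    exact/measurable_EFinP.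
  have h0 u : (0 <= (EFin \o h) u)%E by rewrite lee_fin.
  have -> : sintegral (mixed_measure mu x S) h =
      (\int[mixed_measure mu x S]_u (EFin \o h) u)%E.
    by rewrite integral_nnsfun// patch_setT.
  rewrite mixed_ge0_integral//.
  rewrite (bigID (fun phi : {ffun 'I_k -> option 'I_n} => pinjective phi))/=.
  rewrite [X in (_ + X)%E]big1 ?adde0 => [|phi phiN].
    apply: lee_sum => phi _; apply: lee_wpmul2l => //.
    apply: ge0_le_integral => //.
    - by move=> u _; rewrite lee_fin.
    - by apply: (measurableT_comp mh); exact: measurable_subst.
    move=> u _; apply: le_trans (hF _) _.
    by rewrite /patch; case: ifP.
  rewrite integral0_eq ?mule0// => u _.
  apply/eqP; rewrite eq_le (h0 (subst x phi u)) andbT (le_trans (hF _))//.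
  by rewrite /patch memNset//; exact: subst_diagonal.
pose G := F \_ (separated c (k := k)).
have mG : measurable_fun [set: k.-tuple X] G.
  by apply/(measurable_restrictT F (measurable_separated cP)); exact: measurable_funS mF.
have G0 u : (0 <= G u)%E by rewrite /G /patch; case: ifP.
apply: (@le_trans _ _ (\int[mixed_measure mu x S]_u G u)%E).
  rewrite mixed_ge0_integral//.
  rewrite [leRHS](bigID (fun phi : {ffun 'I_k -> option 'I_n} =>
    pinjective phi))/=.
  rewrite -[leLHS]adde0; apply: leeD; last first.
    apply: sume_ge0 => phi _; apply: mule_ge0 => //.
    by apply: integral_ge0 => u _; exact: G0.
  apply: lee_sum => phi phiI; apply: lee_wpmul2l => //.
  rewrite le_eqVlt; apply/orP; left; apply/eqP.
  apply: ge0_ae_eq_integral => //.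
    by apply: (measurableT_comp mG); exact: measurable_subst.
  apply: filterS (null_subst_separated cP xs phiI) => u su _.
  by rewrite /G /patch mem_set.
rewrite [leRHS]integral_mkcond [leLHS]ge0_integralTE// [leRHS]ge0_integralTE//.
apply: ereal_sup_le => _ [h /= hG <-]; exists h => // u.
apply: le_trans (hG u) _; rewrite /G /patch; case: ifPn => [us|_].
  by rewrite mem_set//; move: us; rewrite inE; exact: separated_off_diagonal.
by case: ifP.
Qed.

Definition coordinate_weight (o : option 'I_n) : R := if o is Some _ then n%:R^-1 else -1.

(** The signed sum over S is the expansion of a product over the coordinates of differences, S being
    the set of factors where the first term is taken. *)
Lemma sum_mixed_weight (phi : 'I_k -> option 'I_n) :
  \sum_(S : {set 'I_k}) (-1) ^+ (k - #|S|) * mixed_weight R S phi =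
  \prod_i coordinate_weight (phi i).
Proof.
transitivity (\prod_i ((phi i != None)%:R * n%:R^-1 + - (phi i == None)%:R : R)).
  rewrite (bigA_distr _ _ (fun i => (phi i != None)%:R * n%:R^-1)
    (fun i => - (phi i == None)%:R)).
  apply: eq_bigr => S _.
  have -> : (-1) ^+ (k - #|S|) = \prod_(i in (~: S)%SET) (-1) :> R.
    by rewrite prodr_const; congr (_ ^+ _);
      rewrite [RHS]finset.cardsCs finset.setCK card_ord.
  rewrite big_mkcond -big_split/=; apply: eq_bigr => i _.
  by rewrite inE; case: (i \in S); rewrite /= ?mul1r ?mulN1r.
apply: eq_bigr => i _; case: (phi i) => [j|] /=.
  by rewrite mul1r subr0.
by rewrite mul0r add0r.
Qed.

(** For each S the positive and negative parts of H are expanded separately and then subtracted.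
    Exchanging the sums over S and [phi] leaves the alternating sum of mixed weights, which
    factorises. *)
Lemma signed_integral_expansion (H : k.-tuple X -> R) :
  measurable_fun [set: k.-tuple X] H ->
  (forall phi : {ffun 'I_k -> option 'I_n}, pinjective phi ->
    (power_measure k mu).-integrable setT (fun u => (H (subst x phi u))%:E)) ->
  signed_integral (empirical R x : subprobability X R) mu (@off_diagonal _ X k) H =
  \sum_(phi : {ffun 'I_k -> option 'I_n} | pinjective phi)
     (\prod_i coordinate_weight (phi i)) * \int[power_measure k mu]_u H (subst x phi u).
Proof.
move=> mH iH.
have mHE : measurable_fun [set: k.-tuple X] (EFin \o H) by exact/measurable_EFinP.
have E S : \int[mixed_measure mu x S]_(u in @off_diagonal _ X k) H u =
    \sum_(phi : {ffun 'I_k -> option 'I_n} | pinjective phi)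
      mixed_weight R S phi * \int[power_measure k mu]_u H (subst x phi u).
  pose I phi (G : k.-tuple X -> \bar R) :=
    (\int[power_measure k mu]_u G (subst x phi u))%E.
  (* Finiteness of both parts is what allows [fine] to pass through the sums and the subtraction. *)
  have fin (phi : {ffun 'I_k -> option 'I_n}) : pinjective phi ->
      I phi (EFin \o H)^\+%E \is a fin_num /\
      I phi (EFin \o H)^\-%E \is a fin_num.
    move=> pI; have iphi := iH _ pI; split; rewrite /I.
      have := integrable_pos_fin_num measurableT iphi.
      by congr (_ \is a fin_num); apply: eq_integral => u _; rewrite !funeposE.
    have := integrable_neg_fin_num measurableT iphi.
    by congr (_ \is a fin_num); apply: eq_integral => u _; rewrite !funenegE.
  rewrite /Rintegral integralE.
  rewrite off_diagonal_ge0_integral//; last exact: measurable_funepos.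
  rewrite off_diagonal_ge0_integral//; last exact: measurable_funeneg.
  transitivity (fine (\sum_(phi : {ffun 'I_k -> option 'I_n} | pinjective phi)
      (mixed_weight R S phi * fine (I phi (EFin \o H)^\+%E))%:E -
    \sum_(phi : {ffun 'I_k -> option 'I_n} | pinjective phi)
      (mixed_weight R S phi * fine (I phi (EFin \o H)^\-%E))%:E)%E).
    by congr (fine (_ - _)%E); apply: eq_bigr => phi /fin[fp fn];
      rewrite EFinM fineK.
  rewrite !sumEFin /= -sumrB; apply: eq_bigr => phi /fin[fp fn].
  rewrite -mulrBr; congr (_ * _).
  rewrite [in RHS]integralE -fineB//.
  congr (fine (_ - _)%E); apply: eq_integral => u _.
    by rewrite !funeposE.
  by rewrite !funenegE.
rewrite /signed_integral.
under eq_bigr do rewrite -/(mixed_measure mu x _) E mulr_sumr.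
rewrite exchange_big/=; apply: eq_bigr => phi _.
by rewrite -sum_mixed_weight mulr_suml; apply: eq_bigr => S _; rewrite mulrA.
Qed.

End off_diagonal_expansion.

(** * Diagrams *)

Section enumeration.
Variables (I : finType) (A : {set I}) (m : nat).
Hypothesis cA : #|A| = m.

(** The enumeration of A indexed by the prescribed size m; it inverts the position
    [index v (enum A)] used in [variable_value]. *)
Definition nth_elt (i : 'I_m) : I := enum_val (cast_ord (esym cA) i).

Lemma nth_elt_inj : injective nth_elt.
Proof. by move=> i j /enum_val_inj /cast_ord_inj. Qed.

Lemma nth_eltP v : reflect (exists i, v = nth_elt i) (v \in A).
Proof.
apply: (iffP idP) => [vA|[i ->]]; last exact: enum_valP.
exists (cast_ord cA (enum_rank_in vA v)).
by rewrite /nth_elt cast_ordK enum_rankK_in.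
Qed.

Lemma index_nth_elt i : index (nth_elt i) (enum A) = i.
Proof.
rewrite /nth_elt /enum_val index_uniq ?enum_uniq//.
by rewrite -cardE; exact: ltn_ord.
Qed.

Lemma nth_index_elt (X : Type) (x0 : X) (y : m.-tuple X) i :
  nth x0 y (index (nth_elt i) (enum A)) = tnth y i.
Proof. by rewrite index_nth_elt -tnth_nth. Qed.

Definition glue (X : Type) (y : 'I_m -> X) (w : I -> X) (v : I) : X :=
  if [pick i | nth_elt i == v] is Some i then y i else w v.

Lemma glue_elt X (y : 'I_m -> X) w i : glue y w (nth_elt i) = y i.
Proof.
by rewrite /glue; case: pickP => [j /eqP/nth_elt_inj -> //|/(_ i)]; rewrite eqxx.
Qed.

Lemma glue_out X (y : 'I_m -> X) w v : v \notin A -> glue y w v = w v.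
Proof.
rewrite /glue; case: pickP => // j /eqP <- /negP []; apply/nth_eltP.
by exists j.
Qed.

Lemma big_nth_elt (V : Type) (idx : V) (op : Monoid.com_law idx) (F : I -> V) :
  \big[op/idx]_(i < m) F (nth_elt i) = \big[op/idx]_(v in A) F v.
Proof.
rewrite [RHS]big_enum_val (reindex (cast_ord (esym cA)))//=.
by exists (cast_ord cA) => i _; rewrite ?cast_ordK ?cast_ordKV.
Qed.

End enumeration.

Section joint.
Variables (k1 k2 : nat) (B : {set edge k1 k2} * {set edge k1 k2}).
Context d (X : measurableType d) (R : realType) (mu : probability X R).
Variables (f : k1.-tuple X -> R) (g : k2.-tuple X -> R).

Local Notation K := (k1 + k2)%N.

(** The product of f and g after identification, before any integration, as a function of all k1 +
    k2 coordinates. All diagrams thus share one space; a coordinate that has been replaced by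
    another is never read. *)
Definition joint (u : K.-tuple X) : R :=
  f [tuple tnth u (identify B (lshift k2 i)) | i < k1] *
  g [tuple tnth u (identify B (rshift k1 j)) | j < k2].

Lemma identify_lshift i : identify B (lshift k2 i) = lshift k2 i.
Proof. by rewrite /identify; case: pickP => // e; rewrite eq_rlshift andbF. Qed.

Lemma identify_rshift e : is_diagram B.1 -> e \in B.1 ->
  identify B (rshift k1 e.2) = lshift k2 e.1.
Proof.
move=> /forall_inP dB eB; rewrite /identify; case: pickP => [e'|/(_ e)].
  move=> /andP[e'B /eqP/rshift_inj ee'].
  by have /forall_inP/(_ _ e'B) := dB _ eB; rewrite ee' eqxx orbT => /eqP ->.
by rewrite eB eqxx.
Qed.

Lemma identify_rshift_out j : (forall e, e \in B.1 -> e.2 != j) ->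
  identify B (rshift k1 j) = rshift k1 j.
Proof.
move=> Nj; rewrite /identify; case: pickP => // e /andP[eB /eqP/rshift_inj ej].
by have := Nj e eB; rewrite ej eqxx.
Qed.

(** Matched vertices go to distinct partners in the first row, unmatched ones stay in the second
    row. So g still reads distinct, hence independent, coordinates. *)
Lemma identify_rshift_inj : is_diagram B.1 ->
  injective (fun j => identify B (rshift k1 j)).
Proof.
move=> dB i j.
have [e /andP[eB /eqP ei]|Ni] := pickP [pred e | (e \in B.1) && (e.2 == i)];
have [e' /andP[e'B /eqP e'j]|Nj] := pickP [pred e | (e \in B.1) && (e.2 == j)].
- rewrite -ei -e'j !identify_rshift// => /lshift_inj ee'.
  move/forall_inP : dB => /(_ _ eB) /forall_inP/(_ _ e'B).
  by rewrite ee' eqxx => /eqP ->.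
- rewrite -ei identify_rshift// identify_rshift_out; last first.
    by move=> e' e'B; have := Nj e'; rewrite /= e'B /= => ->.
  by move/eqP; rewrite eq_lrshift.
- rewrite -e'j identify_rshift// identify_rshift_out; last first.
    by move=> e eB; have := Ni e; rewrite /= eB /= => ->.
  by move/eqP; rewrite eq_rlshift.
- rewrite !identify_rshift_out; last 2 first.
  + by move=> e eB; have := Nj e; rewrite /= eB /= => ->.
  + by move=> e eB; have := Ni e; rewrite /= eB /= => ->.
  exact: rshift_inj.
Qed.

Hypothesis mf : measurable_fun [set: k1.-tuple X] f.
Hypothesis mg : measurable_fun [set: k2.-tuple X] g.

Lemma measurable_joint : measurable_fun setT joint.
Proof.
apply: measurable_funM.
  apply: (measurableT_comp mf); apply/measurable_fun_tnthP => i.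
  rewrite (_ : _ \o _ = fun u => tnth u (identify B (lshift k2 i))).
    exact: measurable_tnth.
  by apply/funext => u; rewrite /= tnth_mktuple.
apply: (measurableT_comp mg); apply/measurable_fun_tnthP => j.
rewrite (_ : _ \o _ = fun u => tnth u (identify B (rshift k1 j))).
  exact: measurable_tnth.
by apply/funext => u; rewrite /= tnth_mktuple.
Qed.

(** Identification is injective on each row, so the squares of both factors are integrable on
    X^(k1+k2), and |ab| <= a^2 + b^2 dominates the product. *)
Lemma integrable_joint : is_diagram B.1 ->
  (power_measure k1 mu).-integrable setT (EFin \o (fun u => f u ^+ 2)) ->
  (power_measure k2 mu).-integrable setT (EFin \o (fun u => g u ^+ 2)) ->
  (power_measure K mu).-integrable setT (EFin \o joint).
Proof.
move=> dB if2 ig2.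
have lI : injective (fun i => identify B (lshift k2 i)).
  by move=> i j; rewrite !identify_lshift => /lshift_inj.
have if2' := iid_integrable (iid_family_inj lI (iid_family_tnth mu K)) if2.
have ig2' := iid_integrable (iid_family_inj (identify_rshift_inj dB)
  (iid_family_tnth mu K)) ig2.
apply: le_integrable (integrableD measurableT if2' ig2') => //.
  by apply/measurable_EFinP; exact: measurable_joint.
move=> u _ /=; rewrite lee_fin /joint normrM.
set a := f _; set b := g _.
rewrite [leRHS]ger0_norm ?addr_ge0 ?sqr_ge0//.
have := sqr_ge0 (`|a| - `|b|).
rewrite sqrrB !real_normK ?num_real// => ab.
have ab0 : 0 <= `|a| * `|b| by rewrite mulr_ge0.
lra.
Qed.

End joint.

(** * Composed functions as partial integrals over all vertices *)

Section compose.
Variables (k1 k2 l p : nat) (B : {set edge k1 k2} * {set edge k1 k2}).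
Hypothesis dB : B \in coloured_diagrams k1 k2 l p.
Context d (X : measurableType d) (R : realType) (mu : probability X R).
Variables (f : k1.-tuple X -> R) (g : k2.-tuple X -> R).
Hypothesis mf : measurable_fun [set: k1.-tuple X] f.
Hypothesis mg : measurable_fun [set: k2.-tuple X] g.

Local Notation K := (k1 + k2)%N.
Local Notation m := (k1 + k2 - l - p)%N.
Let cR := card_remaining dB.
Let cI := card_integrated dB.

Lemma identify_idem v : identify B (identify B v) = identify B v.
Proof.
have [e /andP[eB /eqP ev]|Nv] :=
    pickP [pred e | (e \in B.1) && (rshift k1 e.2 == v)].
  rewrite -ev identify_rshift ?identify_lshift//.
  by move: dB; rewrite inE => /and4P[].
suff E : identify B v = v by rewrite !E.
by rewrite /identify; case: pickP => // e; have := Nv e; rewrite /= => ->.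
Qed.

Lemma eq_joint (u u' : K.-tuple X) :
  (forall v, v \in remaining B :|: integrated B -> tnth u v = tnth u' v) ->
  joint B f g u = joint B f g u'.
Proof.
move=> uu'.
have E v : tnth u (identify B v) = tnth u' (identify B v).
  apply: uu'; rewrite !inE identify_idem eqxx/=.
  by case: (_ \in _).
congr (f _ * g _); apply: eq_from_tnth => i; rewrite !tnth_mktuple; exact: E.
Qed.

Let values (y : m.-tuple X) (z : p.-tuple X) : K.-tuple X :=
  [tuple variable_value B y z v | v < K].

Definition mix (y : m.-tuple X) (w : K.-tuple X) : K.-tuple X :=
  [tuple glue cR (tnth y) (tnth w) v | v < K].

Let measurable_values y : measurable_fun setT (values y).
Proof.
apply/measurable_fun_tnthP => v.
rewrite (_ : _ \o _ = fun z => variable_value B y z v); last first.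
  by apply/funext => z; rewrite /= tnth_mktuple.
rewrite /variable_value; case: (boolP (v \in integrated B)) => [vI|_].
  have /(nth_eltP cI)[i ->] := vI.
  under eq_fun do rewrite nth_index_elt.
  exact: measurable_tnth.
exact: measurable_cst.
Qed.

(** The p integrated variables are replaced by a full tuple w over all vertices. Of w only the
    integrated coordinates matter: those of remaining vertices are overwritten by y, and the others
    are not read by [joint]. *)
Lemma compose_diagram_mix (y : m.-tuple X) :
  compose_diagram B mu f g p y =
  fine (\int[power_measure K mu]_w (joint B f g (mix y w))%:E).
Proof.
transitivity (fine (\int[power_measure p mu]_z (joint B f g (values y z))%:E)).
  congr fine; apply: eq_integral => z _; congr EFin.
  rewrite /joint; congr (f _ * g _); apply: eq_from_tnth => i;
  by rewrite !tnth_mktuple.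
have mj : measurable_fun setT (fun z => (joint B f g (values y z))%:E).
  apply/measurable_EFinP; apply: measurableT_comp; first exact: measurable_joint.
  exact: measurable_values.
have iidw := iid_family_inj (@nth_elt_inj _ _ _ cI) (iid_family_tnth mu K).
rewrite -(iid_integral iidw mj); congr fine; apply: eq_integral => w _.
congr EFin; apply: eq_joint => v; rewrite !tnth_mktuple /variable_value.
case: (boolP (v \in integrated B)) => [vI _|vI].
  rewrite glue_out ?inE ?vI ?andbF//.
  have /(nth_eltP cI)[i ->] := vI.
  by rewrite nth_index_elt tnth_mktuple.
rewrite finset.in_setU (negbTE vI) orbF => /(nth_eltP cR)[i ->].
by rewrite nth_index_elt glue_elt.
Qed.

Variables (n : nat) (x : 'I_n -> X).

Definition extend (theta : 'I_m -> option 'I_n) (v : 'I_K) : option 'I_n :=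
  glue cR theta (fun=> None) v.

Lemma subst_mix theta (y : m.-tuple X) (w : K.-tuple X) v :
  v \in remaining B :|: integrated B ->
  tnth (mix (subst x theta y) w) v = tnth (subst x (extend theta) (mix y w)) v.
Proof.
by rewrite !tnth_mktuple /extend /glue; case: pickP => // i _; rewrite tnth_mktuple.
Qed.

(** Each vertex reads one coordinate of the pair (y, w), and distinct vertices read distinct
    ones. *)
Let iid_mix : iid_family mu (power_measure m mu \x power_measure K mu)%E
  (fun v t => glue cR (tnth t.1) (tnth t.2) v).
Proof.
pose h v : 'I_m + 'I_K := glue cR inl inr v.
have hI : injective h.
  move=> v v'; rewrite /h /glue; case: pickP => [i /eqP <-|_];
    by case: pickP => [i' /eqP <-|_] // [->].
have := iid_family_inj hI (iid_family_prod (iid_family_tnth mu m) (iid_family_tnth mu K)).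
congr iid_family; apply/funext => v; apply/funext => t.
by rewrite /h /glue; case: pickP.
Qed.

(** Tonelli applied to the positive and negative parts gives measurability of the inner integral at
    every y, including those where it is infinite or undefined. *)
Lemma measurable_compose_diagram :
  measurable_fun [set: m.-tuple X] (compose_diagram B mu f g p).
Proof.
rewrite (_ : compose_diagram _ _ _ _ _ = fine \o (fun y =>
    \int[power_measure K mu]_w (joint B f g (mix y w))%:E)%E); last first.
  by apply/funext => y; rewrite compose_diagram_mix.
apply: measurableT_comp => //.
have mj : measurable_fun setT (fun t => (joint B f g (mix t.1 t.2))%:E).
  apply/measurable_EFinP; apply: measurableT_comp; first exact: measurable_joint.
  exact: measurable_mktuple iid_mix.
under eq_fun do rewrite integralE.
apply: emeasurable_funB.
  have := measurable_fun_fubini_tonelli_F (m2 := power_measure K mu) _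
    (measurable_funepos mj) (fun t => funepos_ge0 _ t).
  congr measurable_fun; apply/funext => y; apply: eq_integral => w _.
  by rewrite !funeposE.
have := measurable_fun_fubini_tonelli_F (m2 := power_measure K mu) _
  (measurable_funeneg mj) (fun t => funeneg_ge0 _ t).
congr measurable_fun; apply/funext => y; apply: eq_integral => w _.
by rewrite !funenegE.
Qed.

(** Fubini: freezing the remaining variables commutes with integrating out the others, and the
    iterated integral is the integral of [joint] over all vertices, with the integrated ones left
    free by [extend]. *)
Lemma compose_diagram_subst (theta : 'I_m -> option 'I_n) :
  (power_measure K mu).-integrable setT
    (fun u => (joint B f g (subst x (extend theta) u))%:E) ->
  (power_measure m mu).-integrable setT
    (fun y => (compose_diagram B mu f g p (subst x theta y))%:E) /\
  \int[power_measure m mu]_y compose_diagram B mu f g p (subst x theta y) =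
  \int[power_measure K mu]_u joint B f g (subst x (extend theta) u).
Proof.
set F := fun u => _ => iF.
have iFm := iid_integrable iid_mix iF.
have mF : measurable_fun setT F := measurable_int _ iF.
pose G := fubini_F (power_measure K mu)
  (fun t => F [tuple glue cR (tnth t.1) (tnth t.2) v | v < K]).
have iG : (power_measure m mu).-integrable setT G := integrable_fubini_F iFm.
have GE y : compose_diagram B mu f g p (subst x theta y) = fine (G y).
  rewrite compose_diagram_mix; congr fine; apply: eq_integral => w _.
  by congr EFin; apply: eq_joint => v; exact: subst_mix.
have mc : measurable_fun setT
    (fun y => (compose_diagram B mu f g p (subst x theta y))%:E).
  apply/measurable_EFinP; apply: measurableT_comp.
    exact: measurable_compose_diagram.
  exact: measurable_subst.
have ic : (power_measure m mu).-integrable setT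
    (fun y => (compose_diagram B mu f g p (subst x theta y))%:E).
  (* Where the inner integral is infinite, [fine] returns 0, which keeps the domination by G;
     equality of the integrals only needs G to be finite almost everywhere. *)
  apply: le_integrable iG => // y _; rewrite GE.
  by case: (G y) => [r| |] //=; rewrite normr0 leey.
split=> //; rewrite /Rintegral; congr fine.
transitivity (\int[power_measure m mu]_y G y)%E.
  apply: ae_eq_integral => //; first exact: measurable_int iG.
  have := integrable_ae measurableT iG.
  by apply: filterS => y yfin _; rewrite GE fineK// yfin.
rewrite /G integral12_prod_meas1//.
by have := iid_integral iid_mix mF.
Qed.

End compose.

(** * Matchings and colours *)

Section matching.
Variables (k1 k2 n : nat) (R : realType).

Local Notation K := (k1 + k2)%N.
Local Notation edges := {set edge k1 k2}.
Local Notation assignment := {ffun 'I_K -> option 'I_n}.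
Local Notation weight := (@coordinate_weight R n).

(* [identify] and [joint] only depend on the edges, not on their colours. *)
Definition colour0 (N : edges) : edges * edges := (N, finset.set0).

Definition fixed_vertices (N : edges) : {set 'I_K} :=
  [set v | identify (colour0 N) v == v]%SET.

Definition common_samples (phi : {ffun 'I_k1 -> option 'I_n})
    (psi : {ffun 'I_k2 -> option 'I_n}) : edges :=
  [set e | (phi e.1 != None) && (phi e.1 == psi e.2)]%SET.

(** The second-row vertex of an edge becomes undefined, its sample being already carried by its
    partner; this keeps the joined assignment injective. *)
Definition join_assignments (phi : {ffun 'I_k1 -> option 'I_n})
    (psi : {ffun 'I_k2 -> option 'I_n}) : assignment :=
  [ffun v : 'I_K => match fintype.split v with
   | inl i => phi i
   | inr j => if [exists i, (i, j) \in common_samples phi psi] then None else psi j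
   end].

(** Describes the image under [match_assignments] of the pairs of partial injections: the first-row
    vertex of every edge is frozen and its second-row vertex is undefined. *)
Definition is_matching (p : edges * assignment) : bool :=
  [&& is_diagram p.1, pinjective p.2,
    [forall e in p.1, p.2 (rshift k1 e.2) == None] &
    [forall e in p.1, p.2 (lshift k2 e.1) != None]].

Definition restrict_assignment (p : edges * assignment) :=
  ([ffun i : 'I_k1 => p.2 (lshift k2 i)],
   [ffun j : 'I_k2 => p.2 (identify (colour0 p.1) (rshift k1 j))])
  : {ffun 'I_k1 -> option 'I_n} * {ffun 'I_k2 -> option 'I_n}.

Definition match_assignments
    (q : {ffun 'I_k1 -> option 'I_n} * {ffun 'I_k2 -> option 'I_n}) :=
  (common_samples q.1 q.2, join_assignments q.1 q.2).

Lemma join_lshift phi psi i : join_assignments phi psi (lshift k2 i) = phi i.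
Proof. by rewrite ffunE (unsplitK (inl _ i)). Qed.

Lemma join_rshift phi psi j : join_assignments phi psi (rshift k1 j) =
  if [exists i, (i, j) \in common_samples phi psi] then None else psi j.
Proof. by rewrite ffunE (unsplitK (inr _ j)). Qed.

Lemma common_samples_diagram (phi : {ffun 'I_k1 -> option 'I_n})
    (psi : {ffun 'I_k2 -> option 'I_n}) :
  pinjective phi -> pinjective psi ->
  is_diagram (common_samples phi psi).
Proof.
move=> /pinjectiveP phiI /pinjectiveP psiI.
apply/forall_inP => -[i j]; rewrite inE /= => /andP[].
case ia: (phi i) => [a|] // _ /eqP ja.
apply/forall_inP => -[i' j']; rewrite inE /= => /andP[].
case ia': (phi i') => [b|] // _ /eqP jb.
apply/implyP => /orP[] /eqP E; move: E ia' jb => <- ia' jb.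
  have ab : a = b by move: ia'; rewrite ia => -[].
  by rewrite (psiI j j' a)// -jb ab.
have ab : a = b by move: jb; rewrite -ja => -[].
by rewrite (phiI i i' a)// ia' ab.
Qed.

Lemma match_assignmentsK (q : {ffun 'I_k1 -> option 'I_n} * {ffun 'I_k2 -> option 'I_n}) :
  pinjective q.1 -> pinjective q.2 ->
  restrict_assignment (match_assignments q) = q.
Proof.
case: q => phi psi /= phiI psiI; have dN := common_samples_diagram phiI psiI.
rewrite /restrict_assignment /=; congr pair; apply/ffunP => j; rewrite ffunE.
  exact: join_lshift.
have [[i j'] /andP[iN /eqP /= jj']|Nj] :=
    pickP [pred e | (e \in common_samples phi psi) && (e.2 == j)].
  have -> : rshift k1 j = rshift k1 (i, j').2 by rewrite -jj'.
  rewrite (identify_rshift (B := colour0 _))// join_lshift.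
  by move: iN; rewrite inE /= jj' => /andP[_ /eqP].
rewrite identify_rshift_out => [|e eN]; last first.
  by have := Nj e; rewrite /= eN /= => ->.
rewrite join_rshift; case: existsP => // -[i iN].
by have := Nj (i, j); rewrite /= iN eqxx.
Qed.

(** The left-hand side is the condition produced by reindexing the pairs of partial injections along
    [restrict_assignment], with [match_assignments] as its section. *)
Lemma is_matchingE p :
  let q := restrict_assignment p in
  (pinjective q.1 && pinjective q.2) && (match_assignments q == p) = is_matching p.
Proof.
case: p => N chi; rewrite /restrict_assignment /match_assignments/=.
set phi := finfun _; set psi := finfun _.
have q1 i : phi i = chi (lshift k2 i) by rewrite ffunE.
have q2 j : psi j = chi (identify (colour0 N) (rshift k1 j)) by rewrite ffunE.
clearbody phi psi.
apply/idP/idP.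
  move=> /andP[/andP[q1I q2I] /eqP[EN Ec]].
  rewrite /is_matching /= -{1}EN common_samples_diagram//=; apply/and3P; split.
  - rewrite -Ec; apply/pinjectiveP => v v' a.
    have /pinjectiveP I1 := q1I; have /pinjectiveP I2 := q2I.
    rewrite -(splitK v) -(splitK v'); case: (fintype.split v) => i;
      case: (fintype.split v') => j /=; rewrite ?join_lshift ?join_rshift.
    + by move=> ia ja; rewrite (I1 i j a).
    + move=> ia; case: existsP => // Nij ja; case: Nij; exists i.
      by rewrite inE /= ia ja eqxx.
    + case: existsP => // Nij ia ja; case: Nij; exists j.
      by rewrite inE /= ia ja eqxx.
    + by case: existsP => // _ ia; case: existsP => // _ ja; rewrite (I2 i j a).
  - apply/forall_inP => -[i j]; rewrite -{1}EN -Ec join_rshift /= => ij.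
    by case: existsP => // Nij; case: Nij; exists i.
  - by apply/forall_inP => -[i j]; rewrite -{1}EN inE q1 => /andP[].
move=> /and4P[/= dN /pinjectiveP cI /forall_inP cN2 /forall_inP cN1].
have I1 : pinjective phi.
  by apply/pinjectiveP => i j a; rewrite !q1 => ia ja;
    exact/(@lshift_inj k1 k2)/(cI _ _ a).
have I2 : pinjective psi.
  apply/pinjectiveP => i j a; rewrite !q2 => ia ja.
  by apply: (identify_rshift_inj (B := colour0 N) dN); exact: (cI _ _ a).
rewrite I1 I2 /=; apply/eqP.
have EN : common_samples phi psi = N.
  apply/setP => -[i j]; rewrite inE /= q1 q2; apply/idP/idP.
    move=> /andP[]; case ia: (chi _) => [a|] // _ /eqP/esym ja.
    have E := cI _ _ _ ja ia.
    have [[i' j'] /andP[eN /eqP /= jj']|Nj] := pickP [pred e | (e \in N) && (e.2 == j)].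
      move: E; rewrite -jj' (identify_rshift (B := colour0 N) (e := (i', j')))//=.
      by move=> /lshift_inj <-.
    move: E; rewrite identify_rshift_out => [|e eN].
      by move/eqP; rewrite eq_rlshift.
    by have := Nj e; rewrite /= eN /= => ->.
  move=> ijN; rewrite (identify_rshift (B := colour0 N) (e := (i, j)))//= eqxx andbT.
  exact: (cN1 _ ijN).
rewrite EN; congr pair; apply/ffunP => v.
rewrite -(splitK v); case: (fintype.split v) => [i|j] /=; first by rewrite join_lshift q1.
rewrite join_rshift EN q2; case: existsP => [[i /cN2/eqP/esym //]|Nj].
rewrite identify_rshift_out// => -[i j'] eN /=; apply/eqP => jj'.
by apply: Nj; exists i; rewrite -jj'.
Qed.

Lemma fixed_lshift N i : lshift k2 i \in fixed_vertices N.
Proof. by rewrite inE identify_lshift. Qed.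

Lemma matched_rshift N (j : 'I_k2) : is_diagram N ->
  (rshift k1 j \notin fixed_vertices N) = (j \in [set e.2 | e in N]%SET).
Proof.
move=> dN; rewrite inE; apply/idP/imsetP.
  have [e /andP[eN /eqP ej] _|Nj] := pickP [pred e | (e \in N) && (e.2 == j)].
    by exists e.
  rewrite identify_rshift_out ?eqxx// => e eN.
  by have := Nj e; rewrite /= eN /= => ->.
by move=> [e eN ->]; rewrite (identify_rshift (B := colour0 N))// eq_lrshift.
Qed.

(** An edge of N joins two vertices frozen at one sample: the two rows count 1/n for each of them,
    while the product over the surviving vertices counts it once. Each edge accounts for the missing
    factor 1/n. *)
Lemma matching_weight p : is_matching p ->
  let q := restrict_assignment p in
  (\prod_i weight (q.1 i)) * (\prod_j weight (q.2 j)) =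
  n%:R^-1 ^+ #|p.1| * \prod_(v in fixed_vertices p.1) weight (p.2 v) :> R.
Proof.
case: p => N chi /and4P[/= dN _ _ /forall_inP cN1].
rewrite [in RHS]big_mkcond big_split_ord/= mulrCA; congr (_ * _).
  by apply: eq_bigr => i _; rewrite ffunE fixed_lshift.
rewrite -big_mkcond/= (bigID (fun j => rshift k1 j \in fixed_vertices N))/= mulrC.
congr (_ * _); last first.
  apply: eq_bigr => j; rewrite inE ffunE => /eqP -> //.
rewrite (eq_bigl (fun j => j \in [set e.2 | e in N]%SET)); last first.
  by move=> j; exact: matched_rshift.
have inj2 : {in N &, injective (fun e : edge k1 k2 => e.2)}.
  move=> e e' eN e'N ee'; move/forall_inP : dN => /(_ _ eN)/forall_inP/(_ _ e'N).
  by rewrite ee' eqxx orbT => /eqP.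
rewrite big_imset//= -prodr_const; apply: eq_bigr => e eN.
rewrite ffunE (identify_rshift (B := colour0 N))//.
by have := cN1 e eN; case: (chi _).
Qed.

Lemma sum_assignments (T : edges -> assignment -> R) :
  \sum_(phi | pinjective (phi : {ffun 'I_k1 -> option 'I_n}))
    \sum_(psi | pinjective (psi : {ffun 'I_k2 -> option 'I_n}))
      (\prod_i weight (phi i)) * (\prod_j weight (psi j)) *
      T (common_samples phi psi) (join_assignments phi psi) =
  \sum_(N | is_diagram N) n%:R^-1 ^+ #|N| *
    \sum_(chi | is_matching (N, chi))
      (\prod_(v in fixed_vertices N) weight (chi v)) * T N chi.
Proof.
rewrite pair_big/= (reindex_onto restrict_assignment match_assignments)/=; last first.
  by move=> q /andP[]; exact: match_assignmentsK.
under eq_bigl do rewrite is_matchingE.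
under [RHS]eq_bigr do rewrite mulr_sumr.
rewrite pair_big_dep/=; apply: eq_big => [[N chi]|[N chi] pM] /=.
  by rewrite andb_idl// => /and4P[].
have /andP[_ /eqP E] : (pinjective (restrict_assignment (N, chi)).1 &&
    pinjective (restrict_assignment (N, chi)).2) &&
    (match_assignments (restrict_assignment (N, chi)) == (N, chi)).
  by rewrite is_matchingE.
rewrite mulrA -(matching_weight pM); congr (_ * _).
by move: E; rewrite /match_assignments/= => -[-> ->].
Qed.

(** Expansion of a product over the elements of A of the factors -1 + 1. *)
Lemma sum_signs (I : finType) (A : {set I}) :
  \sum_(S : {set I} | S \subset A) (-1) ^+ #|S| = (A == finset.set0)%:R :> R.
Proof.
transitivity (\prod_i ((if i \in A then -1 else 0) + 1 : R)).
  rewrite (bigA_distr 1 +%R (fun i => if i \in A then -1 else 0) (fun=> 1)).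
  rewrite big_mkcond/=; apply: eq_bigr => S _; rewrite -big_mkcond/=.
  case: ifPn => [SA|/fintype.subsetPn[i iS iA]].
    rewrite -prodr_const; apply: eq_bigr => i iS.
    by rewrite (fintype.subsetP SA).
  by rewrite (bigD1 i)//= (negbTE iA) mul0r.
have [->|[i iA]] := set_0Vmem A.
  by rewrite eqxx big1// => i _; rewrite inE add0r.
rewrite (bigD1 i)//= iA addNr mul0r; case: eqP => // A0.
by rewrite A0 inE in iA.
Qed.

Lemma remaining_colour (N N1 : edges) :
  remaining (N, N1) = (fixed_vertices N :\: integrated (N, N1))%SET.
Proof. by apply/setP => v; rewrite !inE andbC. Qed.

(* The edges of N whose vertex is not frozen contribute the alternating sum over
   the subsets N1 of the set of these edges. *)
Lemma sum_colours N (T : assignment -> R) : is_diagram N ->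
  \sum_(N1 : edges | N1 \subset N)
    \sum_(chi : assignment | pinjective chi &&
        [forall v, (v \notin remaining (N, N1)) ==> (chi v == None)])
      (\prod_(v in remaining (N, N1)) weight (chi v)) * T chi =
  \sum_(chi | is_matching (N, chi))
    (\prod_(v in fixed_vertices N) weight (chi v)) * T chi.
Proof.
move=> dN.
pose Z (chi : assignment) := [set e in N | chi (lshift k2 e.1) == None]%SET.
pose Q (chi : assignment) :=
  pinjective chi && [forall e in N, chi (rshift k1 e.2) == None].
have inj1 (N1 : edges) : N1 \subset N ->
    {in N1 &, injective (fun e : edge k1 k2 => lshift k2 e.1)}.
  move=> /fintype.subsetP N1N e e' /N1N eN /N1N e'N /lshift_inj ee'.
  move/forall_inP : dN => /(_ _ eN)/forall_inP/(_ _ e'N).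
  by rewrite ee' eqxx => /eqP.
(* The first-row vertices of N1 are undefined, of weight -1 each, so extending the product from the
   remaining vertices to all fixed ones costs the sign (-1)^|N1|. The constraint on [chi] becomes
   that N1 is a subset of [Z chi]. *)
transitivity (\sum_(N1 : edges | N1 \subset N) \sum_(chi | Q chi && (N1 \subset Z chi))
    (-1) ^+ #|N1| * ((\prod_(v in fixed_vertices N) weight (chi v)) * T chi)).
  apply: eq_bigr => N1 N1N; apply: eq_big => chi.
    rewrite /Q -andbA; congr (_ && _); apply/forallP/andP.
      move=> H; split.
        apply/forall_inP => e eN; have := H (rshift k1 e.2).
        rewrite remaining_colour inE negb_and matched_rshift//.
        suff -> : e.2 \in [set e.2 | e in N]%SET by rewrite orbT.
        by apply/imsetP; exists e.
      apply/fintype.subsetP => e eN1; rewrite inE (fintype.subsetP N1N)//=.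
      have := H (lshift k2 e.1); rewrite remaining_colour inE negb_and negbK.
      suff -> : lshift k2 e.1 \in integrated (N, N1) by [].
      by apply/imsetP; exists e.
    move=> [/forall_inP H2 /fintype.subsetP H1] v; apply/implyP.
    rewrite remaining_colour inE negb_and negbK => /orP[/imsetP[e eN1 ->]|].
      by have := H1 _ eN1; rewrite inE => /andP[].
    rewrite -(splitK v); case: (fintype.split v) => i /=; first by rewrite fixed_lshift.
    by rewrite matched_rshift// => /imsetP[e eN ->]; exact: H2.
  move=> /andP[_ /forallP H]; rewrite mulrA; congr (_ * _).
  have HI : integrated (N, N1) \subset fixed_vertices N.
    by apply/fintype.subsetP => v /imsetP[e _ ->]; rewrite fixed_lshift.
  rewrite [X in _ = _ * X](big_setID (integrated (N, N1)))/=.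
  rewrite (finset.setIidPr HI) -remaining_colour.
  rewrite [X in _ = _ * (X * _)]big_imset/=; last exact: inj1.
  suff -> : \prod_(e in N1) weight (chi (lshift k2 e.1)) = (-1) ^+ #|N1|.
    by rewrite mulrA -expr2 sqrr_sign mul1r.
  rewrite -prodr_const; apply: eq_bigr => e eN1; have := H (lshift k2 e.1).
  rewrite remaining_colour inE negb_and negbK.
  suff -> : lshift k2 e.1 \in integrated (N, N1) by move=> /eqP ->.
  by apply/imsetP; exists e.
rewrite (exchange_big_dep Q)/=; last by move=> N1 chi _ /andP[].
transitivity (\sum_(chi | Q chi) (Z chi == finset.set0)%:R *
    ((\prod_(v in fixed_vertices N) weight (chi v)) * T chi)).
  apply: eq_bigr => chi Qchi; rewrite -sum_signs mulr_suml; apply: eq_bigl => N1.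
  rewrite Qchi andb_idl// => /fintype.subsetP NZ.
  by apply/fintype.subsetP => e /NZ; rewrite inE => /andP[].
rewrite [RHS](eq_bigl (fun chi => Q chi && (Z chi == finset.set0))); last first.
  move=> chi; rewrite /is_matching /= dN /Q /= -andbA; do 2 congr (_ && _).
  apply/forall_inP/eqP => [H|Z0 e eN].
    apply/setP => e; rewrite !inE; apply/negP => /andP[eN].
    by rewrite (negbTE (H e eN)).
  by apply/negP => eZ; have := finset.in_set0 e; rewrite -Z0 inE eN eZ.
rewrite [RHS]big_mkcondr; apply: eq_bigr => chi _.
by case: eqP => _; rewrite ?mul1r ?mul0r.
Qed.

End matching.

(** * Expansion of the product and of the composed functions *)

Section extension_sums.
Variables (k1 k2 l p n : nat) (B : {set edge k1 k2} * {set edge k1 k2}).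
Variables (R : realType) (dB : B \in coloured_diagrams k1 k2 l p).

Local Notation K := (k1 + k2)%N.
Local Notation m := (k1 + k2 - l - p)%N.
Local Notation assignment := {ffun 'I_K -> option 'I_n}.

Lemma pinjective_extend (theta : 'I_m -> option 'I_n) :
  pinjective (extend dB theta) = pinjective theta.
Proof.
apply/pinjectiveP/pinjectiveP => I i j a.
  move=> ia ja; apply: (nth_elt_inj (cA := card_remaining dB)).
  by apply: (I _ _ a); rewrite /extend glue_elt.
rewrite /extend /glue; case: pickP => // i' /eqP <- ia; case: pickP => // j' /eqP <- ja.
by rewrite (I i' j' a).
Qed.

(** Assignments of the variables of the composed function correspond to assignments of all vertices
    that are undefined off the remaining ones. This puts all diagrams on a common index set. *)
Lemma sum_extend (T : assignment -> R) :
  \sum_(theta : {ffun 'I_m -> option 'I_n} | pinjective theta)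
    (\prod_i coordinate_weight R (theta i)) * T [ffun v => extend dB theta v] =
  \sum_(chi : assignment | pinjective chi &&
      [forall v, (v \notin remaining B) ==> (chi v == None)])
    (\prod_(v in remaining B) coordinate_weight R (chi v)) * T chi.
Proof.
pose h (chi : assignment) : {ffun 'I_m -> option 'I_n} :=
  [ffun i => chi (nth_elt (card_remaining dB) i)].
pose h' (theta : {ffun 'I_m -> option 'I_n}) : assignment :=
  [ffun v => extend dB theta v].
rewrite (reindex_onto h h')/=; last first.
  by move=> theta _; apply/ffunP => i; rewrite !ffunE /extend glue_elt.
have hh' (chi : assignment) : (h' (h chi) == chi) =
    [forall v, (v \notin remaining B) ==> (chi v == None)].
  apply/eqP/forallP => [<- v|H].
    by apply/implyP => vR; rewrite ffunE /extend glue_out.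
  apply/ffunP => v; rewrite ffunE /extend.
  case: (boolP (v \in remaining B)) => [/(nth_eltP (card_remaining dB))[i ->]|vR].
    by rewrite glue_elt ffunE.
  by rewrite glue_out//; apply/esym/eqP; have /implyP := H v; apply.
apply: eq_big => [chi|chi /andP[_ /eqP E]]; rewrite ?hh'.
  case: (boolP [forall v, _]) => [|_]; last by rewrite !andbF.
  rewrite -hh' => /eqP E; rewrite !andbT -{2}E -pinjective_extend.
  by apply/pinjectiveP/pinjectiveP => I i j a; have := I i j a; rewrite !ffunE.
rewrite -[[ffun v => _]]/(h' (h chi)) E; congr (_ * _).
rewrite -(big_nth_elt (card_remaining dB)) /=.
by apply: eq_bigr => i _; rewrite ffunE.
Qed.

End extension_sums.

Section composition_expansion.
Variables (k1 k2 n : nat).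
Context d (X : measurableType d) (R : realType) (mu : probability X R).
Variables (f : k1.-tuple X -> R) (g : k2.-tuple X -> R).
Variables (x : 'I_n -> X).
Hypothesis mf : measurable_fun [set: k1.-tuple X] f.
Hypothesis mg : measurable_fun [set: k2.-tuple X] g.

Local Notation K := (k1 + k2)%N.
Local Notation assignment := {ffun 'I_K -> option 'I_n}.

Definition joint_integral (N : {set edge k1 k2}) (chi : assignment) : R :=
  \int[power_measure K mu]_u joint (colour0 N) f g (subst x chi u).

Hypothesis joint_integrable : forall N (chi : assignment),
  is_diagram N -> pinjective chi -> (power_measure K mu).-integrable setT
    (fun u => (joint (colour0 N) f g (subst x chi u))%:E).

(** The two ends of an edge of [common_samples] carry the same sample, so identifying them changes
    no argument of g; elsewhere nothing is identified. *)
Lemma joint_join (phi : {ffun 'I_k1 -> option 'I_n})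
    (psi : {ffun 'I_k2 -> option 'I_n}) u :
  pinjective phi -> pinjective psi ->
  joint (colour0 (common_samples phi psi)) f g (subst x (join_assignments phi psi) u) =
  f (subst x phi [tuple tnth u (lshift k2 i) | i < k1]) *
  g (subst x psi [tuple tnth u (rshift k1 j) | j < k2]).
Proof.
move=> phiI psiI; have dN := common_samples_diagram phiI psiI.
rewrite /joint; congr (f _ * g _); apply: eq_from_tnth => j; rewrite !tnth_mktuple.
  by rewrite identify_lshift join_lshift.
have [[i j'] /andP[iN /eqP /= jj']|Nj] :=
    pickP [pred e | (e \in common_samples phi psi) && (e.2 == j)].
  have -> : rshift k1 j = rshift k1 (i, j').2 by rewrite -jj'.
  rewrite (identify_rshift (B := colour0 _))// join_lshift /=.
  move: iN; rewrite inE /= jj' => /andP[+ /eqP <-].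
  by case: (phi i).
rewrite identify_rshift_out => [|e eN]; last first.
  by have := Nj e; rewrite /= eN /= => ->.
rewrite join_rshift; case: existsP => // -[i iN].
by have := Nj (i, j); rewrite /= iN eqxx.
Qed.

(** The product of the integrals is an integral over the product of the two spaces, whose
    coordinates together form an independent family indexed by all vertices. *)
Lemma integral_subst_prod (phi : {ffun 'I_k1 -> option 'I_n})
    (psi : {ffun 'I_k2 -> option 'I_n}) :
  pinjective phi -> pinjective psi ->
  (power_measure k1 mu).-integrable setT (fun u => (f (subst x phi u))%:E) ->
  (power_measure k2 mu).-integrable setT (fun u => (g (subst x psi u))%:E) ->
  pinjective (join_assignments phi psi) ->
  (\int[power_measure k1 mu]_u f (subst x phi u)) *
  (\int[power_measure k2 mu]_u g (subst x psi u)) =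
  joint_integral (common_samples phi psi) (join_assignments phi psi).
Proof.
move=> phiI psiI iF iG chiI; have dN := common_samples_diagram phiI psiI.
have iJ := joint_integrable dN chiI.
have sI : injective (@fintype.split k1 k2) := can_inj (@splitK k1 k2).
have iid2 := iid_family_inj sI
  (iid_family_prod (iid_family_tnth mu k1) (iid_family_tnth mu k2)).
have iJ2 := iid_integrable iid2 iJ.
have E (t : k1.-tuple X * k2.-tuple X) :
    joint (colour0 (common_samples phi psi)) f g
      (subst x (join_assignments phi psi)
      [tuple match fintype.split v with inl i => tnth t.1 i
        | inr i => tnth t.2 i end | v < K]) =
    f (subst x phi t.1) * g (subst x psi t.2).
  rewrite joint_join//; congr (f (subst x phi _) * g (subst x psi _));
    apply: eq_from_tnth => i; rewrite !tnth_mktuple.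
    by rewrite (unsplitK (inl _ i)).
  by rewrite (unsplitK (inr _ i)).
have fG := integrable_fin_num measurableT iG.
rewrite /joint_integral /Rintegral.
rewrite -(iid_integral iid2 (measurable_int _ iJ)) -integral12_prod_meas1//.
transitivity (fine (\int[power_measure k1 mu]_y
    ((f (subst x phi y))%:E * \int[power_measure k2 mu]_z (g (subst x psi z))%:E))%E).
  rewrite -(fineK fG) integralZr// fineM//.
  exact: integrable_fin_num.
congr fine; apply: eq_integral => y _; rewrite -integralZl//.
by apply: eq_integral => z _; rewrite E.
Qed.

Lemma Rintegral_lincomb k (I : finType) (P : pred I) (a : R)
    (h : I -> k.-tuple X -> R) :
  (forall i, P i -> (power_measure k mu).-integrable setT (EFin \o h i)) ->
  (power_measure k mu).-integrable setT
    (fun u => (a * \sum_(i | P i) h i u)%:E) /\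
  \int[power_measure k mu]_u (a * \sum_(i | P i) h i u) =
  a * \sum_(i | P i) \int[power_measure k mu]_u h i u.
Proof.
move=> ih.
pose h' i u := if P i then h i u else 0.
have ih' i : (power_measure k mu).-integrable setT (EFin \o h' i).
  rewrite /h'; case: (boolP (P i)) => Pi; first exact: ih.
  exact: integrable0.
have E u : \sum_(i | P i) h i u = \sum_i h' i u by rewrite big_mkcond.
have isum : (power_measure k mu).-integrable setT
    (EFin \o (fun u => \sum_(i | P i) h i u)).
  have := integrable_sum (P := xpredT) measurableT (index_enum I) (fun i _ => ih' i).
  by congr (integrable _ _ _); apply/funext => u; rewrite sumEFin /= E.
split.
  have := integrableZl measurableT a isum.
  by congr (integrable _ _ _); apply/funext => u; rewrite /= EFinM.
rewrite RintegralZl//; congr (_ * _).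
rewrite /Rintegral; under eq_integral do rewrite E -sumEFin.
rewrite integral_sum//.
transitivity (fine (\sum_(i | P i) (\int[power_measure k mu]_u h i u)%:E)%E).
  congr fine; rewrite [RHS]big_mkcond/=; apply: eq_bigr => i _; rewrite /h'.
  case: (boolP (P i)) => Pi; last by rewrite integral0.
  by rewrite fineK// integrable_fin_num//; exact: ih.
by rewrite sumEFin.
Qed.

Variable c : nat -> X -> nat.
Hypothesis cP : is_cells mu c.
Hypothesis xs : forall i j, i != j -> ~ same_cells c (x i) (x j).

(** The signed integral is expanded over the partial injections of its variables, the sum over
    diagrams is pulled out by linearity, and each partial injection is extended to all vertices. *)
Lemma signed_integral_f_circ_g l p :
  signed_integral (empirical R x : subprobability X R) mu (@off_diagonal _ X _)
    (f_circ_g mu f g l p) =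
  ((k1 - l)`! * (k2 - l)`! * (l - p)`! * p`!)%:R / (k1`! * k2`!)%:R *
  \sum_(B in coloured_diagrams k1 k2 l p)
    \sum_(chi : assignment | pinjective chi &&
      [forall v, (v \notin remaining B) ==> (chi v == None)])
    (\prod_(v in remaining B) coordinate_weight R (chi v)) * joint_integral B.1 chi.
Proof.
set a := _ / _.
have comp B (dB : B \in coloured_diagrams k1 k2 l p)
    (theta : {ffun 'I_(k1 + k2 - l - p) -> option 'I_n}) : pinjective theta ->
  (power_measure (k1 + k2 - l - p) mu).-integrable setT
    (fun y => (compose_diagram B mu f g p (subst x theta y))%:E) /\
  \int[power_measure (k1 + k2 - l - p) mu]_y
    compose_diagram B mu f g p (subst x theta y) =
  joint_integral B.1 [ffun v => extend dB theta v].
  move=> tI.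
  have E u : subst x [ffun v => extend dB theta v] u = subst x (extend dB theta) u.
    by apply: eq_from_tnth => v; rewrite !tnth_mktuple ffunE.
  have iC : (power_measure K mu).-integrable setT
      (fun u => (joint B f g (subst x (extend dB theta) u))%:E).
    have dN : is_diagram B.1 by have := dB; rewrite inE => /and4P[].
    have cI : pinjective [ffun v => extend dB theta v].
      move: tI; rewrite -(pinjective_extend dB) => /pinjectiveP cI.
      by apply/pinjectiveP => i j b; rewrite !ffunE; exact: cI.
    have := joint_integrable dN cI.
    by congr (integrable _ _ _); apply/funext => u; rewrite E.
  have [iJ JE] := compose_diagram_subst mf mg iC.
  by split=> //; rewrite JE; apply: eq_Rintegral => u _; rewrite E.
rewrite (signed_integral_expansion cP xs); last 2 first.
- apply: measurable_funM; first exact: measurable_cst.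
  under eq_fun do rewrite big_mkcond.
  apply: measurable_sum => B; case: (boolP (B \in _)) => dB; last exact: measurable_cst.
  exact: (measurable_compose_diagram dB).
- move=> theta tI.
  by have [] := @Rintegral_lincomb _ _ (mem (coloured_diagrams k1 k2 l p)) a
    (fun B y => compose_diagram B mu f g p (subst x theta y))
    (fun B dB => proj1 (comp B dB theta tI)).
transitivity (\sum_(theta : {ffun 'I_(k1 + k2 - l - p) -> option 'I_n} | pinjective theta)
   \sum_(B in coloured_diagrams k1 k2 l p) a * ((\prod_i coordinate_weight R (theta i)) *
    \int[power_measure (k1 + k2 - l - p) mu]_y
      compose_diagram B mu f g p (subst x theta y))).
  apply: eq_bigr => theta tI.
  have [_ ->] := @Rintegral_lincomb _ _ (mem (coloured_diagrams k1 k2 l p)) a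
    (fun B y => compose_diagram B mu f g p (subst x theta y))
    (fun B dB => proj1 (comp B dB theta tI)).
  rewrite mulrCA mulr_sumr mulr_sumr; apply: eq_bigr => B _.
  by rewrite mulrCA.
rewrite exchange_big/= mulr_sumr; apply: eq_bigr => B dB.
rewrite -(sum_extend dB (joint_integral B.1)) mulr_sumr; apply: eq_bigr => theta tI.
by have [_ ->] := comp B dB theta tI.
Qed.

End composition_expansion.

Lemma pinjective_join k1 k2 n (phi : {ffun 'I_k1 -> option 'I_n})
    (psi : {ffun 'I_k2 -> option 'I_n}) :
  pinjective phi -> pinjective psi -> pinjective (join_assignments phi psi).
Proof.
move=> phiI psiI.
have : is_matching (match_assignments (phi, psi)).
  by rewrite -is_matchingE match_assignmentsK//= phiI psiI /=.
by case/and4P.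
Qed.

(** * Sums over coloured diagrams, grouped by their numbers of edges *)

Section coloured_sums.
Variables k1 k2 : nat.

Lemma card_diagram (N : {set edge k1 k2}) : is_diagram N -> (#|N| <= minn k1 k2)%N.
Proof.
move=> /forall_inP dN.
have inj b : {in N &, injective (fun e : edge k1 k2 => if b then inl e.1 else inr e.2)}.
  move=> e e' eN e'N ee'; have /forall_inP/(_ _ e'N) := dN _ eN.
  by case: b ee' => -[->]; rewrite eqxx ?orbT => /eqP.
rewrite leq_min; apply/andP; split.
  rewrite -[X in (_ <= X)%N]card_ord.
  rewrite -(card_in_imset (f := fun e => e.1) (D := mem N)) ?max_card//.
  by move=> e e' eN e'N /= ee'; apply: (inj true) => //; rewrite ee'.
rewrite -[X in (_ <= X)%N]card_ord.
rewrite -(card_in_imset (f := fun e => e.2) (D := mem N)) ?max_card//.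
by move=> e e' eN e'N /= ee'; apply: (inj false) => //; rewrite ee'.
Qed.

(** Partition by |N| and then by |N1|; [inord] loses nothing because |N| is at most min(k1, k2) and
    |N1| at most |N|. *)
Lemma sum_coloured_diagrams (R : nmodType)
    (F : {set edge k1 k2} * {set edge k1 k2} -> R) :
  \sum_(l < (minn k1 k2).+1) \sum_(p < l.+1)
    \sum_(B in coloured_diagrams k1 k2 l p) F B =
  \sum_(N : {set edge k1 k2} | is_diagram N)
    \sum_(N1 : {set edge k1 k2} | N1 \subset N) F (N, N1).
Proof.
rewrite [RHS]pair_big_dep/= [RHS](eq_bigr F); last by case.
rewrite [RHS](partition_big
  (fun B : {set edge k1 k2} * {set edge k1 k2} =>
    inord #|B.1| : 'I_(minn k1 k2).+1) xpredT)//=.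
apply: eq_bigr => l _.
rewrite [RHS](partition_big
  (fun B : {set edge k1 k2} * {set edge k1 k2} => inord #|B.2| : 'I_l.+1) xpredT)//=.
apply: eq_bigr => p _; apply: eq_bigl => -[N N1]; rewrite inE /= -!andbA.
apply/and4P/and4P => -[dN N1N].
  by move=> /eqP Nl /eqP N1p; split=> //; rewrite ?Nl ?N1p inord_val.
move=> /eqP lN /eqP pN; have El : #|N| = l.
  by rewrite -lN inordK// ltnS card_diagram.
split=> //; first by rewrite El.
by rewrite -pN inordK// ltnS -El subset_leq_card.
Qed.

End coloured_sums.

(** * The product of two normalised integrals: almost sure conditions and constants *)

Unset Implicit Arguments.
Set Strict Implicit.
Set Printing Implicit Defensive.

Theorem lemma2 (R : realType)
    (d d' : measure_display) (X : measurableType d) (Omega : measurableType d')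
    (mu : probability X R) (P : probability Omega R)
    (k1 k2 n : nat) (xi : 'I_n -> {RV P >-> X})
    (f : k1.-tuple X -> R) (g : k2.-tuple X -> R) :
  non_atomic mu ->
  (1 <= k1)%N -> (1 <= k2)%N -> (1 <= n)%N ->
  iid_with_distribution xi mu ->
  f \in Lfun (power_measure k1 mu) 2%:E ->
  g \in Lfun (power_measure k2 mu) 2%:E ->
  {ae P, forall w,
    J mu (xi^~ w) f * J mu (xi^~ w) g =
    \sum_(l < (minn k1 k2).+1) \sum_(p < l.+1)
      (k1 + k2 - l - p)`!%:R /
        ((k1 - l)`! * (k2 - l)`! * (l - p)`! * p`!)%:R *
      n%:R `^ (- ((l - p)%:R / 2)) *
      J mu (xi^~ w) (f_circ_g mu f g l p)}.
Proof.
move=> mu_na _ _ n0 iidxi f2 g2.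
have [c cP] := exists_cells mu_na.
have iidf := iid_family_RVs iidxi.
have mf : measurable_fun [set: k1.-tuple X] f.
  by move: f2 => /andP[+ _]; rewrite inE.
have mg : measurable_fun [set: k2.-tuple X] g.
  by move: g2 => /andP[+ _]; rewrite inE.
have Lint k (h : k.-tuple X -> R) : h \in Lfun (power_measure k mu) 2%:E ->
    (power_measure k mu).-integrable setT (EFin \o h).
  by move=> h2; apply/Lfun1_integrable; apply: Lfun_subset12 h2;
    rewrite fin_num_measure.
(* Four almost sure properties of the samples follow. Each is a conjunction over finitely many
   indices, and everything after them is deterministic, for a fixed w. *)
have aef : {ae P, forall w, forall phi : {ffun 'I_k1 -> option 'I_n}, pinjective phi ->
    (power_measure k1 mu).-integrable setT (fun u => (f (subst (xi^~ w) phi u))%:E)}.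
  apply: filter_forall => phi; case: (boolP (pinjective phi)) => phiI.
    by apply: filterS (ae_integrable_subst iidf phiI (Lint _ _ f2)).
  exact: nearW.
have aeg : {ae P, forall w, forall psi : {ffun 'I_k2 -> option 'I_n}, pinjective psi ->
    (power_measure k2 mu).-integrable setT (fun u => (g (subst (xi^~ w) psi u))%:E)}.
  apply: filter_forall => psi; case: (boolP (pinjective psi)) => psiI.
    by apply: filterS (ae_integrable_subst iidf psiI (Lint _ _ g2)).
  exact: nearW.
have aej : {ae P, forall w, forall (N : {set edge k1 k2})
      (chi : {ffun 'I_(k1 + k2) -> option 'I_n}), is_diagram N -> pinjective chi ->
    (power_measure (k1 + k2) mu).-integrable setT
      (fun u => (joint (colour0 N) f g (subst (xi^~ w) chi u))%:E)}.
  apply: filter_forall => N; apply: filter_forall => chi.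
  case: (boolP (is_diagram N && pinjective chi)) => [/andP[dN chiI]|NI].
    have := integrable_joint (B := colour0 N) mf mg dN
      (Lfun2_integrable_sqr f2) (Lfun2_integrable_sqr g2).
    by move=> /(ae_integrable_subst iidf chiI); apply: filterS.
  by apply: nearW => w dN chiI; rewrite dN chiI in NI.
have aes : {ae P, forall w, forall i j, i != j ->
    ~ same_cells c (xi i w) (xi j w)}.
  apply: filter_forall => i; apply: filter_forall => j.
  have [_|ij] := eqVneq i j; first exact: nearW.
  exists [set w | same_cells c (xi i w) (xi j w)]; split.
  - by apply: (measurable_same_cells cP); exact: (proj1 iidf).
  - exact: (iid_same_cells2 cP ij iidf).
  - by move=> w /= Nw; apply: contrapT => sw; apply: Nw.
apply: filterS3 (filterI aef aeg) aej aes => w [iF iG] iJ xs.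
have nN0 : (n%:R : R) != 0 by rewrite pnatr_eq0 -lt0n.
have JE k (h : k.-tuple X -> R) :
  J mu (xi^~ w) h = n%:R `^ (k%:R / 2) / k`!%:R * signed_integral
    (empirical R (xi^~ w) : subprobability X R) mu (@off_diagonal _ X k) h by [].
pose T := joint_integral mu f g (xi^~ w).
pose W (B : {set edge k1 k2} * {set edge k1 k2}) :=
  \sum_(chi : {ffun 'I_(k1 + k2) -> option 'I_n} | pinjective chi &&
      [forall v, (v \notin remaining B) ==> (chi v == None)])
    (\prod_(v in remaining B) coordinate_weight R (chi v)) * T B.1 chi.
(* The pairs of partial injections are regrouped into matchings; the colours are then introduced
   through the cancellation of [sum_colours], the factor n^(-|N|) being independent of them. *)
have prodE :
    signed_integral (empirical R (xi^~ w) : subprobability X R) mu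
      (@off_diagonal _ X k1) f *
    signed_integral (empirical R (xi^~ w) : subprobability X R) mu
      (@off_diagonal _ X k2) g =
    \sum_(N : {set edge k1 k2} | is_diagram N)
      \sum_(N1 : {set edge k1 k2} | N1 \subset N) n%:R^-1 ^+ #|N| * W (N, N1).
  rewrite (signed_integral_expansion cP xs mf iF) (signed_integral_expansion cP xs mg iG).
  transitivity (\sum_(phi | pinjective (phi : {ffun 'I_k1 -> option 'I_n}))
    \sum_(psi | pinjective (psi : {ffun 'I_k2 -> option 'I_n}))
      (\prod_i coordinate_weight R (phi i)) * (\prod_j coordinate_weight R (psi j)) *
      T (common_samples phi psi) (join_assignments phi psi)).
    rewrite mulr_suml; apply: eq_bigr => phi phiI.
    rewrite mulr_sumr; apply: eq_bigr => psi psiI.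
    rewrite mulrACA; congr (_ * _).
    exact: (integral_subst_prod iJ phiI psiI (iF _ phiI) (iG _ psiI)
      (pinjective_join phiI psiI)).
  rewrite sum_assignments; apply: eq_bigr => N dN.
  by rewrite -mulr_sumr; congr (_ * _); rewrite -(sum_colours _ dN).
rewrite !JE mulrACA prodE -(sum_coloured_diagrams (fun B => n%:R^-1 ^+ #|B.1| * W B)).
rewrite mulr_sumr; apply: eq_bigr => -[l /= llt] _.
rewrite mulr_sumr; apply: eq_bigr => -[p /= plt] _.
have lk : (l <= k1)%N && (l <= k2)%N by rewrite -leq_min -ltnS.
have /andP[lk1 lk2] := lk.
have pl : (p <= l)%N by rewrite -ltnS.
(* Both exponents equal (k1 + k2)/2 - l. *)
have powE : n%:R `^ (k1%:R / 2) * n%:R `^ (k2%:R / 2) * n%:R^-1 ^+ l =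
    n%:R `^ (- ((l - p)%:R / 2)) * n%:R `^ ((k1 + k2 - l - p)%:R / 2) :> R.
  have pD a b : n%:R `^ (a + b) = n%:R `^ a * n%:R `^ b :> R.
    by rewrite powRD// nN0 implybT.
  rewrite exprVn -powR_mulrn// -powRN -!pD; congr (_ `^ _).
  rewrite natrB// -subnDA natrB; last by rewrite leq_add// (leq_trans pl).
  by rewrite !natrD; field.
rewrite JE [X in _ = _ * (_ * X)](signed_integral_f_circ_g mf mg iJ cP xs l p).
rewrite (eq_bigr (fun B => n%:R^-1 ^+ l * W B)); last first.
  by move=> B; rewrite inE => /and4P[_ _ /eqP -> _].
rewrite -mulr_sumr.
rewrite -[X in _ = _ * (_ * (_ * X))]/(\sum_(B in coloured_diagrams k1 k2 l p) W B).
have fact0 k : (k`!%:R : R) != 0 by rewrite pnatr_eq0 -lt0n fact_gt0.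
have A0 : ((k1 - l)`! * (k2 - l)`! * (l - p)`! * p`!)%:R != 0 :> R.
  by rewrite !natrM !mulf_neq0.
(* M stands for (k1+k2-l-p)! and A for the product of factorials normalising the composed function:
   both cancel, leaving 1/(k1! k2!) on either side. *)
have alg (a b M A V1 V2 q V3 V4 S : R) : a != 0 -> b != 0 -> M != 0 -> A != 0 ->
    V1 * V2 * q = V3 * V4 ->
    V1 / a * (V2 / b) * (q * S) = M / A * V3 * (V4 / M * (A / (a * b) * S)).
  move=> a0 b0 M0 A1 E; transitivity (V1 * V2 * q * S / (a * b)).
    by field; rewrite a0 b0.
  by rewrite E; field; rewrite A1 a0 b0 M0.
by rewrite [(k1`! * k2`!)%:R]natrM; exact: alg.
Qed.
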